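(* Let $\mathcal{A}$ and $\mathcal{B}$ be uniform algebras on compact Hausdorff spaces $X$ and $Y$ respectively and $T$ a map from $\mathcal{A}^{-1}$ onto $\mathcal{B}^{-1}$ such that the inclusion $$\sigma_{\pi}(Tf\,Tg)\subset\sigma_{\pi}(fg)$$ holds for every pair $f,g\in\mathcal{A}^{-1}$. Then $(T1)^2=1$ and there exists a homeomorphism $\phi$ from $\mathrm{Ch}(\mathcal{B})$ onto $\mathrm{Ch}(\mathcal{A})$ such that the equality $$Tf(y)=T1(y)\,f(\phi(y)),\quad y\in\mathrm{Ch}(\mathcal{B})$$ holds for every $f\in\mathcal{A}^{-1}$. Thus $T/T1$ (the map $f\mapsto Tf/T1$) is extended to an isometrical algebra isomorphism from $\mathcal{A}$ onto $\mathcal{B}$. In particular, $T$ is extended to an isometrical algebra isomorphism from $\mathcal{A}$ onto $\mathcal{B}$ if $T1=1$.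
   Context: A uniform algebra on a compact Hausdorff space $X$ is a uniformly closed subalgebra of $C(X)$ (complex-valued continuous functions) which contains the constants and separates the points of $X$. $A^{-1}$ denotes the group of invertible elements of $A$. The peripheral spectrum of $f$ is $\sigma_{\pi}(f)=\{z\in\sigma(f):|z|=\mathrm{r}(f)\}$, where $\sigma(f)$ is the spectrum and $\mathrm{r}(f)$ the spectral radius. $\mathrm{Ch}(\mathcal{A})\subset X$ is the Choquet boundary of $\mathcal{A}$. The map $T$ is not assumed to be linear or multiplicative. *)

(* Defs.v *)
From HB Require Import structures.
From mathcomp Require Import all_boot all_order all_algebra.
From mathcomp Require Import all_classical all_reals all_analysis.
From mathcomp Require Import complex.

Set Implicit Arguments.
Unset Strict Implicit.
Unset Printing Implicit Defensive.

Import Order.TTheory GRing.Theory Num.Theory.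
Import numFieldNormedType.Exports Normc.

Local Open Scope classical_set_scope.
Local Open Scope ring_scope.
Local Open Scope complex_scope.

(* The complex numbers are R[i]; their modulus, with values in R, is normc.
   R[i] carries no topology in the library, its regular algebra R[i]^o does
   (the one given by the modulus), hence the casts to R[i]^o below.
   The ring operations on X -> R[i] are pointwise. *)

Record uniform_algebra (R : realType) (X : topologicalType)
    (A : set (X -> R[i])) : Prop := UniformAlgebra {
  ualg_continuous : forall f, A f -> continuous (f : X -> R[i]^o);
  ualg_cst : forall c : R[i], A (cst c);
  ualg_add : forall f g, A f -> A g -> A (f + g);
  ualg_mul : forall f g, A f -> A g -> A (f * g);
  ualg_closed : closed (A : set {uniform X -> R[i]^o});
  ualg_separates : forall x y : X, x <> y -> exists2 f, A f & f x <> f y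
}.

Section Spectrum.
Variables (R : realType) (X : topologicalType) (A : set (X -> R[i])).

Definition invertibles : set (X -> R[i]) :=
  [set f | A f /\ exists2 g, A g & f * g = 1].

Definition spectrum (f : X -> R[i]) : set R[i] :=
  [set z | ~ invertibles (f - cst z)].

Definition spectral_radius (f : X -> R[i]) : R :=
  sup [set normc z | z in spectrum f].

Definition peripheral_spectrum (f : X -> R[i]) : set R[i] :=
  [set z | spectrum f z /\ normc z = spectral_radius f].

End Spectrum.

Definition supnorm (R : realType) (X : Type) (f : X -> R[i]) : R :=
  sup [set normc (f x) | x in [set: X]].

Section ChoquetBoundary.
Variables (R : realType) (X : topologicalType) (A : set (X -> R[i])).

(* A functional on A is represented by a map on all of X -> R[i], of which only
   the values on A matter. A state is a linear functional L on A with
   ||L|| = L 1 = 1; as L 1 = 1 and ||1|| = 1, only ||L|| <= 1 has to be asked. *)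
Definition state (L : (X -> R[i]) -> R[i]) : Prop :=
  [/\ forall (a : R[i]) f g, A f -> A g -> L (cst a * f + g) = a * L f + L g,
      forall f, A f -> normc (L f) <= supnorm f
    & L 1 = 1].

Definition extreme_state (L : (X -> R[i]) -> R[i]) : Prop :=
  state L /\
  forall (L1 L2 : (X -> R[i]) -> R[i]) (t : R),
    state L1 -> state L2 -> 0 < t < 1 ->
    (forall f, A f -> L f = t%:C * L1 f + (1 - t)%:C * L2 f) ->
    forall f, A f -> L1 f = L f /\ L2 f = L f.

Definition choquet_boundary : set X :=
  [set x | extreme_state (fun f => f x)].

End ChoquetBoundary.

(* The subsets D and E carry the subspace topologies. *)
Definition homeomorphism_on (Y X : topologicalType) (D : set Y) (E : set X)
    (phi : Y -> X) : Prop :=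
  [/\ set_bij D E phi,
      {within D, continuous phi}
    & exists2 psi : X -> Y,
        {in D, cancel phi psi} & {within E, continuous psi}].

(* Since S is linear, preserving the norm is the same as preserving distances. *)
Definition isometric_algebra_isomorphism (R : realType) (X Y : topologicalType)
    (A : set (X -> R[i])) (B : set (Y -> R[i]))
    (S : (X -> R[i]) -> (Y -> R[i])) : Prop :=
  [/\ set_bij A B S,
      forall (a : R[i]) f g, A f -> A g -> S (cst a * f + g) = cst a * S f + S g,
      forall f g, A f -> A g -> S (f * g) = S f * S g
    & forall f, A f -> supnorm (S f) = supnorm f].

(* Main.v *)
Require Import Defs.
From HB Require Import structures.
From mathcomp Require Import all_boot all_order all_algebra.
From mathcomp Require Import all_classical all_reals all_analysis.
From mathcomp Require Import complex.
From mathcomp Require Import ring lra.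
Import Order.TTheory GRing.Theory Num.Theory.
Import numFieldNormedType.Exports Normc.

(** Neumann series show that the peripheral spectrum of f is the set of values
    of f of maximal modulus (peripheral_spectrumP). So the hypothesis makes T
    norm-multiplicative, || T f T g || = || f g ||, and moreover says that every
    value of T f T g of maximal modulus is a value of f g of maximal modulus.

    The Choquet boundary is accessible through peaking functions. If the
    evaluation at x is an extreme state, every positive functional that
    represents x kills the squares of the functions Re h with h(x) = 0
    (representing_functional_square), and the Hahn-Banach theorem then produces
    functions of A that peak at x (choquet_weak_peak). Conversely a point with
    peaking functions is an extreme state (has_peaks_choquet). Minimal closed
    sets admitting peaking functions are points, so every f in A attains its
    maximum modulus on the Choquet boundary (choquet_max_ex); in particular f is
    determined by its values there.

    Norm-multiplicativity alone determines T up to phases. Comparison of moduli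
    is a matter of norms: |f| <= |g| exactly when || f / g || <= 1, so T
    preserves it in both directions (corr_le) and inverts moduli of inverses
    (corr_inv). For y in the Choquet boundary of B, the sets where |g| >= 1, for
    the g with |T g(y)| > 1, are directed downwards, because a peak at y can be
    fitted below two given moduli (dominated_peak). By compactness they have a
    common point x, and |T f(y)| = |f(x)| for all invertible f (corr_point); x
    lies in the Choquet boundary of A (corr_choquet). The situation is symmetric
    in A and B, so y |-> x is a homeomorphism phi of the Choquet boundaries.

    The phase comes from the spectral inclusion. T 1 is unimodular and (T 1)^2
    has its values in the peripheral spectrum of 1, so (T 1)^2 = 1. At
    x = phi(y), Bishop's construction gives an invertible q with q(x) = 1 such
    that |q| and |f q| are maximal at x, while |q| is maximal only where q = 1
    and |f q| only where q = 1 and f = f(x) (peaking_multiplier). The inclusion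
    for the pairs q, 1 and f, q then gives T q(y) T 1(y) = 1 and
    T f(y) T q(y) = f(x), that is T f(y) = T 1(y) f(x)
    (spectral_representation).

    Finally, each f in A becomes invertible after adding a large constant, so
    that f |-> T 1 T(f + c) - c is composition with phi on the Choquet boundary,
    where B is determined; this is the isomorphism sought. *)

Set Implicit Arguments.
Unset Strict Implicit.
Unset Printing Implicit Defensive.

Local Open Scope classical_set_scope.
Local Open Scope ring_scope.
Local Open Scope complex_scope.

Local Notation Re := complex.Re.
Local Notation Im := complex.Im.

(** * Moduli and real parts of complex numbers *)

Section ComplexNumbers.
Variable R : realType.
Implicit Types z w : R[i].

Lemma normcE z : normc z = Num.sqrt (Re z ^+ 2 + Im z ^+ 2).
Proof. by case: z. Qed.

Lemma normc_ge0 z : 0 <= normc z.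
Proof. by rewrite normcE sqrtr_ge0. Qed.

Lemma normc_sqr z : normc z ^+ 2 = Re z ^+ 2 + Im z ^+ 2.
Proof. by rewrite normcE sqr_sqrtr// addr_ge0// sqr_ge0. Qed.

Lemma normcD z w : normc (z + w) <= normc z + normc w.
Proof. exact: le_normcD. Qed.

Lemma normcNE z : normc (- z) = normc z.
Proof. exact: normcN. Qed.

Lemma normcB z w : normc (z - w) = normc (w - z).
Proof. by rewrite -normcNE opprB. Qed.

Lemma normc_dist z w : `|normc z - normc w| <= normc (z - w).
Proof.
have := normcD (z - w) w; have := normcD (w - z) z.
rewrite !subrK [normc (w - z)]normcB ler_norml => *; lra.
Qed.

Lemma normc_real (a : R) : normc a%:C = `|a|.
Proof. by rewrite normcE /= expr0n /= addr0 sqrtr_sqr. Qed.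

Lemma normc_eq0 z : (normc z == 0) = (z == 0).
Proof. by apply/eqP/eqP => [/eq0_normc|->] //; rewrite normc0. Qed.

Lemma normc_gt0 z : (0 < normc z) = (z != 0).
Proof. by rewrite lt0r normc_eq0 normc_ge0 andbT. Qed.

Lemma ReD z w : Re (z + w) = Re z + Re w.
Proof. by case: z w => [a b] [c d]. Qed.

Lemma ImD z w : Im (z + w) = Im z + Im w.
Proof. by case: z w => [a b] [c d]. Qed.

Lemma ReN z : Re (- z) = - Re z. Proof. by case: z. Qed.

Lemma ImN z : Im (- z) = - Im z. Proof. by case: z. Qed.

Lemma ReM z w : Re (z * w) = Re z * Re w - Im z * Im w.
Proof. by case: z w => [a b] [c d]. Qed.

Lemma ImM z w : Im (z * w) = Re z * Im w + Im z * Re w.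
Proof. by case: z w => [a b] [c d]. Qed.

Definition ReImE := (ReD, ImD, ReN, ImN, ReM, ImM).

Lemma norm_Re_le z : `|Re z| <= normc z.
Proof.
by rewrite -(ger0_norm (normc_ge0 z)) -ler_sqr ?nnegrE ?normr_ge0//
  !real_normK ?num_real// normc_sqr lerDl sqr_ge0.
Qed.

Lemma norm_Im_le z : `|Im z| <= normc z.
Proof.
by rewrite -(ger0_norm (normc_ge0 z)) -ler_sqr ?nnegrE ?normr_ge0//
  !real_normK ?num_real// normc_sqr lerDr sqr_ge0.
Qed.

Lemma Re_le_normc z : Re z <= normc z.
Proof. exact: le_trans (ler_norm _) (norm_Re_le z). Qed.

Lemma normc_le_ReIm z : normc z <= `|Re z| + `|Im z|.
Proof.
case: z => a b; have -> : a +i* b = a%:C + b*i by simpc.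
apply: le_trans (normcD _ _) _; rewrite normc_real.
suff -> : normc (b*i) = `|b| by rewrite ReD ImD /= addr0 add0r.
by rewrite normcE /= expr0n /= add0r sqrtr_sqr.
Qed.

(** A unimodular factor rotates any complex number onto the nonnegative axis;
    this turns bounds on real parts into bounds on moduli. *)
Lemma normc_rotate z : exists2 a, normc a = 1 & a * z = (normc z)%:C.
Proof.
have [->|z0] := eqVneq z 0.
  by exists 1; rewrite ?normc1 ?mulr0 ?normc0.
have nz0 : normc z != 0 by rewrite normc_eq0.
exists ((normc z)%:C / z); last by rewrite divfK.
by rewrite normcM normc_real normcV ger0_norm ?normc_ge0// divff.
Qed.

Lemma normcX z n : normc (z ^+ n) = normc z ^+ n.
Proof.
by elim: n => [|n IH]; rewrite ?expr0 ?normc1// !exprS normcM IH.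
Qed.

Lemma eq_of_normc_small z w : (forall e : R, 0 < e -> normc (z - w) <= e) ->
  z = w.
Proof.
move=> h; apply/eqP; rewrite -subr_eq0 -normc_eq0 eq_le normc_ge0 andbT.
by apply/ler_addgt0Pr => e e0; rewrite add0r h.
Qed.

Lemma ltc_normc z (e : R) : (`|z| < e%:C) = (normc z < e).
Proof. by rewrite -ltcR. Qed.

End ComplexNumbers.

Section Topology.
Variables (R : realType) (X : topologicalType).

Lemma continuous_contraction (h : R[i] -> R) (f : X -> R[i]) :
  (forall z w, `|h z - h w| <= normc (z - w)) ->
  continuous (f : X -> R[i]^o) -> continuous (h \o f).
Proof.
move=> hL cf x; apply/cvgrPdist_lt => e e0.
have /cvgrPdist_lt/(_ e%:C) := cf x; rewrite ltcR => /(_ e0).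
apply: filterS => t /=; rewrite ltc_normc; exact: le_lt_trans.
Qed.

(** In a compact set, a family of closed sets directed downwards is the base of
    a filter, so that its members have a common point. *)
Lemma compact_directed (I : Type) (P : set I) (F : I -> set X) (C : set X) :
  compact C -> P !=set0 -> (forall i, P i -> closed (F i)) ->
  (forall i j, P i -> P j ->
    exists2 k, P k & C `&` F k `<=` F i `&` F j) ->
  (forall i, P i -> C `&` F i !=set0) ->
  exists2 x, C x & forall i, P i -> F i x.
Proof.
move=> cC [i0 Pi0] clF dirF neF.
have FF : ProperFilter (filter_from P (fun i => C `&` F i)).
  apply: filter_from_proper => //; apply: filter_from_filter; first by exists i0.
  move=> i j Pi Pj; have [k Pk kij] := dirF _ _ Pi Pj.
  by exists k => // x Ckx; have [? ?] := kij _ Ckx; case: Ckx.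
have [|x [Cx clx]] := cC _ FF; first by exists i0 => // x [].
exists x => // i Pi; apply: (clF _ Pi) => U Ux.
have [|y [[Cy Fy] Uy]] := clx (C `&` F i) U _ Ux; first by exists i.
by exists y.
Qed.

Lemma continuous_max_ex (f : X -> R) (C : set X) : compact C -> C !=set0 ->
  continuous f -> exists2 x, C x & forall z, C z -> f z <= f x.
Proof.
move=> cC C0 cf.
have [|c cC' cmax] := compact_EVT_max C0 cC (f := f).
  exact: continuous_subspaceT.
exists c => [|z Cz]; first exact: set_mem.
by apply: cmax; exact: mem_set.
Qed.

Lemma closed_le_level (f : X -> R) c : continuous f -> closed [set x | f x <= c].
Proof.
by move=> cf; apply: (preimage_closed (f := f) (D := [set y | y <= c])) => [x _|];
  [exact: cf|exact: closed_le].
Qed.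

Lemma closed_ge_level (f : X -> R) c : continuous f -> closed [set x | c <= f x].
Proof.
by move=> cf; apply: (preimage_closed (f := f) (D := [set y | c <= y])) => [x _|];
  [exact: cf|exact: closed_ge].
Qed.

Lemma open_lt_level (f : X -> R) c : continuous f -> open [set x | f x < c].
Proof.
by move=> cf; apply: (open_comp (f := f) (D := [set y | y < c])) => [x _|];
  [exact: cf|exact: open_lt].
Qed.

Lemma open_gt_level (f : X -> R) c : continuous f -> open [set x | c < f x].
Proof.
by move=> cf; apply: (open_comp (f := f) (D := [set y | c < y])) => [x _|];
  [exact: cf|exact: open_gt].
Qed.

End Topology.

(** * Basic properties of uniform algebras *)

Definition fun_inv (R : realType) (X : Type) (f : X -> R[i]) : X -> R[i] :=
  fun x => (f x)^-1.

Lemma geometric_small (R : realType) (r e : R) : 0 <= r < 1 -> 0 < e ->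
  exists n, r ^+ n <= e.
Proof.
move=> /andP[r0 r1] e0.
have /cvgrPdist_le/(_ e e0)[n _ hn] : r ^+ n @[n --> \oo] --> 0.
  by apply: cvg_expr; rewrite ger0_norm.
exists n; have := hn n (leqnn n); rewrite /= sub0r normrN ger0_norm//.
exact: exprn_ge0.
Qed.

Section UniformAlgebra.
Variables (R : realType) (X : topologicalType).
Hypothesis Xcompact : compact [set: X].
Hypothesis X0 : [set: X] !=set0.
Variable A : set (X -> R[i]).
Hypothesis uA : uniform_algebra A.
Implicit Types f g u : X -> R[i].

Lemma ualg_uniform_limit f :
  (forall e : R, 0 < e -> exists2 g, A g & forall x, normc (f x - g x) <= e) ->
  A f.
Proof.
move=> h; apply: (ualg_closed uA) => U.
rewrite uniform_nbhs => -[E [entE EU]].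
move: entE; rewrite -entourage_from_ballE => -[/= e e0 eE].
have ereal : e = (Re e)%:C by rewrite RRe_real// gtr0_real.
have Re0 : 0 < Re e by rewrite -ltcR -ereal.
have [g Ag fg] := h (Re e / 2) (ltac:(lra)).
exists g; split => //; apply: EU => y _ /=; apply: eE => /=.
rewrite -ball_normE /ball_/= ereal ltc_normc.
by apply: le_lt_trans (fg y) _; lra.
Qed.

Lemma ualg_1 : A 1. Proof. exact: (ualg_cst uA 1). Qed.

Lemma ualg_scale c f : A f -> A (cst c * f).
Proof. by move=> Af; apply: (ualg_mul uA) => //; exact: (ualg_cst uA). Qed.

Lemma ualg_opp f : A f -> A (- f).
Proof.
move=> Af; have -> : - f = cst (-1) * f by apply/funext => x; rewrite /= !fctE mulN1r.
exact: ualg_scale.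
Qed.

Lemma ualg_sub f g : A f -> A g -> A (f - g).
Proof. by move=> Af Ag; apply: (ualg_add uA) => //; exact: ualg_opp. Qed.

Lemma ualg_subc f c : A f -> A (f - cst c).
Proof. by move=> Af; apply: ualg_sub => //; exact: (ualg_cst uA). Qed.

Lemma continuous_norm f : A f -> continuous (fun x => normc (f x)).
Proof.
move=> Af; apply: continuous_contraction (ualg_continuous uA Af).
exact: normc_dist.
Qed.

Lemma continuous_Re f : A f -> continuous (fun x => Re (f x)).
Proof.
move=> Af; apply: continuous_contraction (ualg_continuous uA Af) => z w.
by rewrite -ReN -ReD norm_Re_le.
Qed.

Lemma norm_max_ex f : A f -> exists x, forall z, normc (f z) <= normc (f x).
Proof.
move=> /continuous_norm /(continuous_max_ex Xcompact X0)[x _ xmax].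
by exists x => z; apply: xmax.
Qed.

Lemma ualg_bounded f : A f -> exists2 M : R, 1 <= M & forall x, normc (f x) <= M.
Proof.
move=> /norm_max_ex[x xmax]; exists (normc (f x) + 1).
  by rewrite lerDr normc_ge0.
by move=> z; rewrite (le_trans (xmax z))// lerDl.
Qed.

Lemma invertiblesP f :
  invertibles A f <-> [/\ A f, A (fun_inv f) & forall x, f x != 0].
Proof.
split=> [[Af [g Ag fg1]]|[Af Ai f0]].
  have fgx x : f x * g x = 1 by have /(congr1 (@^~ x)) := fg1.
  have f0 x : f x != 0.
    by apply: contraPneq (fgx x) => ->; rewrite mul0r; apply/eqP; rewrite eq_sym oner_neq0.
  split=> //; suff -> : fun_inv f = g by [].
  by apply/funext => x; rewrite /fun_inv -[LHS]mulr1 -(fgx x) mulKf.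
split=> //; exists (fun_inv f) => //; apply/funext => x.
by rewrite !fctE /fun_inv mulfV.
Qed.

Lemma invertibles_ualg f : invertibles A f -> A f.
Proof. by case. Qed.

Lemma invertibles_neq0 f x : invertibles A f -> f x != 0.
Proof. by move=> /invertiblesP[]. Qed.

Lemma invertibles_inv f : invertibles A f -> invertibles A (fun_inv f).
Proof.
move=> /invertiblesP[Af Ai f0]; apply/invertiblesP; split=> [//||x].
  by rewrite (_ : fun_inv _ = f)//; apply/funext => x; rewrite /fun_inv invrK.
by rewrite invr_neq0.
Qed.

Lemma invertibles_mul f g :
  invertibles A f -> invertibles A g -> invertibles A (f * g).
Proof.
move=> [Af [f' Af' ff']] [Ag [g' Ag' gg']]; split; first exact: (ualg_mul uA).
by exists (f' * g'); [exact: (ualg_mul uA)|rewrite mulrACA ff' gg' mulr1].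
Qed.

Lemma invertibles_cst c : c != 0 -> invertibles A (cst c).
Proof.
move=> c0; split; first exact: (ualg_cst uA).
exists (cst c^-1); first exact: (ualg_cst uA).
by apply/funext => x; rewrite !fctE mulfV.
Qed.

Lemma invertibles_1 : invertibles A 1.
Proof. exact: (invertibles_cst (oner_neq0 _)). Qed.

Lemma invertibles_scale c f : c != 0 -> invertibles A f ->
  invertibles A (cst c * f).
Proof. by move=> /invertibles_cst; exact: invertibles_mul. Qed.

Lemma invertibles_exp f n : invertibles A f -> invertibles A (f ^+ n).
Proof.
move=> If; elim: n => [|n IH]; first by rewrite expr0; exact: invertibles_1.
by rewrite exprS; exact: invertibles_mul.
Qed.

(** The Neumann series: the partial sums satisfy s' = 1 + f s, a relation of
    which the pointwise inverse of 1 - f is the fixed point, so the error is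
    multiplied by f at each step. *)
Lemma invertibles_neumann f (r : R) : A f -> r < 1 ->
  (forall x, normc (f x) <= r) -> invertibles A (1 - f).
Proof.
move=> Af r1 fr.
have r0 : 0 <= r by have [x _] := X0; exact: le_trans (normc_ge0 _) (fr x).
have nge x : 1 - r <= normc (1 - f x).
  have := normcD (1 - f x) (f x); rewrite subrK normc1; have := fr x; lra.
have f1 x : 1 - f x != 0 by rewrite -normc_gt0; have := nge x; lra.
apply/invertiblesP; split => //; first exact: ualg_sub ualg_1 Af.
set G := fun_inv _.
have GE x : G x = 1 + f x * G x.
  have f1x := f1 x; rewrite /G /fun_inv !fctE -[X in _ = X + _](divff f1x).
  by rewrite -mulrDl subrK mul1r.
have approx n : exists2 s, A s &
    forall x, normc (G x - s x) <= r ^+ n * (1 - r)^-1.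
  elim: n => [|n [s As sG]].
    exists 0 => [|x]; first exact: (ualg_cst uA 0).
    rewrite subr0 expr0 mul1r normcV; have r1' : 0 < 1 - r by lra.
    by rewrite lef_pV2 ?nge ?posrE// (lt_le_trans r1' (nge x)).
  exists (1 + f * s) => [|x]; first exact: (ualg_add uA ualg_1 (ualg_mul uA Af As)).
  rewrite (_ : _ - _ = f x * (G x - s x)); last first.
    by rewrite {1}GE !fctE /= mulrBr [RHS]addrC; rewrite opprD addrACA subrr add0r addrC.
  rewrite normcM exprS -mulrA.
  by apply: ler_pM; rewrite ?normc_ge0.
apply: ualg_uniform_limit => e e0.
have r1' : 0 < 1 - r by rewrite subr_gt0.
have r01 : 0 <= r < 1 by rewrite r0.
have [n hn] := geometric_small r01 (mulr_gt0 e0 r1').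
have [s As sG] := approx n; exists s => // x.
by rewrite (le_trans (sG x))// ler_pdivrMr.
Qed.

(** A multiple of 1 + u by a small positive constant lies within distance less
    than 1 of the constant 1, since 1 + u takes its values in a bounded part of
    the half-plane of real parts at least 1. *)
Lemma invertibles_1D u : A u -> (forall x, 0 <= Re (u x)) ->
  invertibles A (1 + u).
Proof.
move=> Au u0; pose v := 1 + u.
have Av : A v := ualg_add uA ualg_1 Au.
have vE x : v x = 1 + u x by [].
have Rev x : 1 <= Re (v x) by rewrite vE ReD /= lerDl.
have [M M1 vM] := ualg_bounded Av.
have M0 : 0 < M by lra.
(* for v = 1 + u, |1 - c v|^2 <= 1 - 2 c + c^2 M^2 = 1 - c *)
pose c : R := (M ^+ 2)^-1; have c0 : 0 < c by rewrite invr_gt0 exprn_gt0.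
have c1 : c <= 1 by rewrite invf_le1 ?exprn_gt0// exprn_ege1.
pose f := 1 - cst c%:C * v.
have Af : A f by apply: ualg_sub ualg_1 _; exact: ualg_scale.
have fr x : normc (f x) <= Num.sqrt (1 - c).
  rewrite normcE ler_wsqrtr//.
  have fE : f x = 1 - c%:C * v x by [].
  have := normc_sqr (v x); have := Rev x.
  have vM2 : normc (v x) ^+ 2 <= M ^+ 2.
    by rewrite ler_sqr ?nnegrE ?normc_ge0 ?(ltW M0).
  have cM : c * M ^+ 2 = 1 by rewrite mulVf// gt_eqF// exprn_gt0.
  rewrite fE !ReImE /=.
  move: (Re (v x)) (Im (v x)) (normc (v x) ^+ 2) vM2 => a b n nM2 a1 nE.
  have : c * (c * n) <= c * 1.
    by rewrite ler_pM2l// -cM ler_pM2l.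
  by rewrite nE; nra.
have sq1 : Num.sqrt (1 - c) < 1.
  by rewrite -[ltRHS]sqrtr1 ltr_sqrt; lra.
have := invertibles_neumann Af sq1 fr.
rewrite /f subKr => /(invertibles_scale (c := c^-1%:C)).
have c0' : c%:C != 0 by rewrite (inj_eq (@complexI R)) gt_eqF.
rewrite (_ : cst _ * (_ * _) = v).
  by apply; rewrite (inj_eq (@complexI R)) invr_eq0 gt_eqF.
by apply/funext => x; rewrite !fctE mulrA fmorphV mulVf// mul1r.
Qed.

Lemma supnorm_ub f x : A f -> normc (f x) <= supnorm f.
Proof.
move=> /ualg_bounded[M _ fM]; apply: ub_le_sup; last by exists x.
by exists M => _ [z _ <-].
Qed.

Lemma supnorm_le f (c : R) : (forall x, normc (f x) <= c) -> supnorm f <= c.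
Proof.
move=> fc; apply: sup_le_ub => [|_ [z _ <-]//].
by have [x _] := X0; exists (normc (f x)), x.
Qed.

End UniformAlgebra.

(** * The peripheral spectrum *)

Lemma eq1_normc1D (R : realType) (w : R[i]) :
  normc w <= 1 -> 2 <= normc (1 + w) -> w = 1.
Proof.
move=> w1 w2.
have s1 : normc w ^+ 2 <= 1.
  by rewrite -[leRHS](expr1n _ 2) ler_sqr ?nnegrE ?normc_ge0.
have s2 : 4 <= normc (1 + w) ^+ 2.
  have -> : 4 = 2 ^+ 2 :> R by rewrite -natrX.
  by rewrite ler_sqr ?nnegrE ?normc_ge0.
move: s1 s2; rewrite !normc_sqr !ReImE /=; case: w {w1 w2} => a b /= s1 s2.
have a1 : a = 1 by nra.
have b0 : b = 0.
  by apply/eqP; rewrite -sqrf_eq0 eq_le sqr_ge0 andbT; move: s1; rewrite a1; nra.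
by rewrite a1 b0.
Qed.

Section Peripheral.
Variables (R : realType) (X : topologicalType).
Hypothesis Xcompact : compact [set: X].
Hypothesis X0 : [set: X] !=set0.
Variable A : set (X -> R[i]).
Hypothesis uA : uniform_algebra A.
Implicit Types f g u : X -> R[i].

Lemma spectrum_range f x : spectrum A f (f x).
Proof.
move=> /(invertibles_neq0 x); apply/negP; rewrite negbK.
by rewrite !fctE subrr.
Qed.

Lemma invertibles_shift f h (z : R[i]) (c : R[i]) r : A h -> r < 1 ->
  (forall x, normc (h x) <= r) -> c != 0 ->
  (forall x, f x - z = c * (1 - h x)) -> ~ spectrum A f z.
Proof.
move=> Ah r1 hr c0 fE; apply; rewrite (_ : f - cst z = cst c * (1 - h)).
  apply: (invertibles_scale uA) => //.
  exact: (invertibles_neumann X0 uA Ah r1 hr).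
by apply/funext => x; exact: fE.
Qed.

Lemma spectrum_le f (m : R) z : A f -> (forall x, normc (f x) <= m) ->
  spectrum A f z -> normc z <= m.
Proof.
move=> Af fm; apply: contraPP => /negP; rewrite -ltNge => mz.
have m0 : 0 <= m by have [x _] := X0; exact: le_trans (normc_ge0 _) (fm x).
have z0 : z != 0 by rewrite -normc_gt0 (le_lt_trans m0 mz).
have nz0 : 0 < normc z by rewrite normc_gt0.
apply: (invertibles_shift (h := cst z^-1 * f) (c := - z) (r := m / normc z)).
- exact: ualg_scale.
- by rewrite ltr_pdivrMr// mul1r.
- by move=> x; rewrite !fctE normcM normcV mulrC ler_pM2r ?invr_gt0.
- by rewrite oppr_eq0.
- by move=> x; rewrite !fctE mulrBr mulNr mulr1 mulNr mulrA mulfV// mul1r opprK addrC.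
Qed.

(** Neumann series identify the spectral radius with the sup norm; a value of
    maximal modulus outside the range of f would not be a spectral value,
    because the mean of 1 and f / z then has norm less than 1. *)
Lemma peripheral_spectrumP f z : A f ->
  peripheral_spectrum A f z <->
  (exists x, f x = z) /\ (forall x, normc (f x) <= normc z).
Proof.
move=> Af; have [x0 x0max] := norm_max_ex Xcompact X0 uA Af.
have -> : peripheral_spectrum A f z <->
    spectrum A f z /\ normc z = normc (f x0).
  rewrite /peripheral_spectrum /= (_ : spectral_radius A f = normc (f x0))//.
  apply/eqP; rewrite eq_le; apply/andP; split.
    apply: sup_le_ub => [|_ [w fw <-]]; last exact: spectrum_le fw.
    by exists (normc (f x0)), (f x0) => //; exact: spectrum_range.
  apply: ub_le_sup; last by exists (f x0) => //; exact: spectrum_range.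
  by exists (normc (f x0)) => _ [w fw <-]; exact: spectrum_le fw.
split=> [[fz zx0]|[[x <-] xmax]]; last first.
  split; first exact: spectrum_range.
  by apply/eqP; rewrite eq_le x0max xmax.
split; last by move=> x; rewrite zx0.
apply: contrapT => nfz.
have z0 : z != 0.
  rewrite -normc_eq0 zx0 normc_eq0; apply/eqP => fx00; apply: nfz.
  by exists x0; apply/eqP; rewrite fx00 eq_sym -normc_eq0 zx0 fx00 normc0.
(* f - z = - 2 z (1 - h) *)
pose h := cst 2^-1 * (1 + cst z^-1 * f).
have Ah : A h.
  apply: (ualg_scale uA); apply: (ualg_add uA (ualg_1 uA)); exact: ualg_scale.
have hE x : h x = 2^-1 * (1 + z^-1 * f x) by [].
have [x1 x1max] := norm_max_ex Xcompact X0 uA Ah.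
have n2 : normc (2%:R^-1 : R[i]) = 2^-1.
  by rewrite normcV -(rmorph_nat (real_complex R)) normc_real ger0_norm.
move: fz; apply: (invertibles_shift Ah (c := - (2 * z)) _ x1max).
- rewrite ltNge hE normcM n2; apply/negP => le1; apply: nfz; exists x1.
  have := @eq1_normc1D _ (z^-1 * f x1); rewrite normcM normcV => /(_ _ _)/esym E.
  rewrite -[LHS](mulKf (x := z^-1)) ?invr_eq0// -E ?invrK ?mulr1//.
    by rewrite zx0 mulrC ler_pdivrMr ?mul1r// -zx0 normc_gt0.
  lra.
- by rewrite oppr_eq0 mulf_neq0// pnatr_eq0.
- move=> x; rewrite hE; move: (f x) => w.
  have t0 : 2%:R != 0 :> R[i] by rewrite pnatr_eq0.
  by field; rewrite z0.
Qed.

End Peripheral.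

(** * The Hahn-Banach theorem *)

Section HahnBanach.
Variables (R : realType) (V : lmodType R) (D : set V).
Hypothesis DD : forall v w, D v -> D w -> D (v + w).
Hypothesis DZ : forall (t : R) v, D v -> D (t *: v).
Implicit Types (p q : V -> R) (v w : V).

Definition sublinear q :=
  (forall v w, D v -> D w -> q (v + w) <= q v + q w) /\
  (forall (t : R) v, 0 <= t -> D v -> q (t *: v) <= t * q v).

Let DN v : D v -> D (- v).
Proof. by move=> Dv; rewrite -scaleN1r; exact: DZ. Qed.

Lemma sublinear_ge q v : sublinear q -> D v -> - q (- v) <= q v.
Proof.
move=> [qD qZ] Dv.
have q0 : 0 <= q 0.
  have D0 : D 0 by rewrite -(subrr v); exact: DD Dv (DN Dv).
  by have := qD _ _ D0 D0; rewrite addr0; lra.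
by have := qD _ _ Dv (DN Dv); rewrite subrr; lra.
Qed.

Lemma sublinearZ q t v : sublinear q -> 0 <= t -> D v -> q (t *: v) = t * q v.
Proof.
move=> sq; rewrite le_eqVlt => /predU1P[<- Dv|t0 Dv].
  have := sublinear_ge sq (DZ 0 Dv); have := sq.2 0 v (lexx 0) Dv.
  by rewrite scale0r oppr0 mul0r; lra.
apply/eqP; rewrite eq_le (sq.2 _ _ (ltW t0) Dv)/=.
have := sq.2 t^-1 (t *: v); rewrite invr_ge0 (ltW t0) => /(_ isT (DZ _ Dv)).
by rewrite scalerA mulVf ?gt_eqF// scale1r ler_pdivlMl.
Qed.

(** The largest sublinear functional below q that is additive along v and agrees
    with q at v; it differs from q unless q itself is additive along v, so that a minimal
    sublinear functional is linear. *)
Definition sublinear_shift q v w : R :=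
  inf [set q (w + t *: v) - t * q v | t in [set t : R | 0 <= t]].

Lemma sublinear_shift_le q v w t : sublinear q -> D v -> D w -> 0 <= t ->
  sublinear_shift q v w <= q (w + t *: v) - t * q v.
Proof.
move=> sq Dv Dw t0; apply: ge_inf; last by exists t.
exists (- q (- w)) => _ [s /= s0 <-].
have := sq.1 _ _ (DD Dw (DZ s Dv)) (DN Dw).
by rewrite addrAC subrr add0r sublinearZ//; lra.
Qed.

Lemma sublinear_shift_ge q v w (c : R) :
  (forall t, 0 <= t -> c <= q (w + t *: v) - t * q v) ->
  c <= sublinear_shift q v w.
Proof.
move=> cq; apply: lb_le_inf => [|_ [t t0 <-]]; last exact: cq.
by exists (q (w + 0 *: v) - 0 * q v), 0 => /=.
Qed.

Lemma sublinear_shift_sublinear q v : sublinear q -> D v ->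
  sublinear (sublinear_shift q v).
Proof.
move=> sq Dv; split=> [w1 w2 Dw1 Dw2|s w s0 Dw].
- rewrite -lerBlDr; apply: sublinear_shift_ge => t1 t10.
  rewrite lerBlDr -lerBlDl; apply: sublinear_shift_ge => t2 t20.
  have := sublinear_shift_le sq Dv (DD Dw1 Dw2) (addr_ge0 t10 t20).
  have := sq.1 _ _ (DD Dw1 (DZ t1 Dv)) (DD Dw2 (DZ t2 Dv)).
  by rewrite addrACA -scalerDl; lra.
- have [->|sn0] := eqVneq s 0.
    rewrite scale0r mul0r.
    have D0 : D 0 by rewrite -(scale0r v); exact: DZ.
    have := sublinear_shift_le sq Dv D0 (lexx 0).
    by rewrite scale0r addr0 mul0r subr0 -{2}(scale0r v) sublinearZ// mul0r.
  have s_gt0 : 0 < s by rewrite lt0r sn0.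
  rewrite -ler_pdivrMl//; apply: sublinear_shift_ge => t t0.
  rewrite ler_pdivrMl//.
  apply: le_trans (sublinear_shift_le sq Dv (DZ s Dw) (mulr_ge0 s0 t0)) _.
  rewrite -scalerA -scalerDr sublinearZ//; last exact: DD Dw (DZ _ Dv).
  by rewrite mulrBr mulrA.
Qed.

Lemma sublinear_shift_le_id q v w : sublinear q -> D v -> D w ->
  sublinear_shift q v w <= q w.
Proof.
move=> sq Dv Dw; have := sublinear_shift_le sq Dv Dw (lexx 0).
by rewrite scale0r addr0 mul0r subr0.
Qed.

Lemma sublinear_minimal_additive q v w : sublinear q ->
  (forall q', sublinear q' -> (forall u, D u -> q' u <= q u) ->
    forall u, D u -> q u <= q' u) ->
  D v -> D w -> q (w + v) = q w + q v.
Proof.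
move=> sq qmin Dv Dw; apply/eqP; rewrite eq_le sq.1//=.
have := qmin _ (sublinear_shift_sublinear sq Dv)
  (fun u => sublinear_shift_le_id sq Dv) w Dw.
have := sublinear_shift_le sq Dv Dw ler01.
by rewrite scale1r mul1r; lra.
Qed.

Lemma sublinear_minimal_ex p : sublinear p ->
  exists q, [/\ sublinear q, forall v, D v -> q v <= p v &
    forall q', sublinear q' -> (forall u, D u -> q' u <= q u) ->
      forall u, D u -> q u <= q' u].
Proof.
move=> sp; pose T := {q | sublinear q /\ forall v, D v -> q v <= p v}.
pose le (q q' : T) := `[< forall v, D v -> sval q' v <= sval q v >].
have [//|q|q1 q2 q3|F totF|[q [sq qp]] qmin] := @ZL_preorder T _ le.
- by exists p.
- exact/asboolP.
- move=> /asboolP h1 /asboolP h2; apply/asboolP => v Dv.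
  exact: le_trans (h2 _ Dv) (h1 _ Dv).
- have [[q0 Fq0]|F0] := pselect (F !=set0); last first.
    exists (exist _ p (conj sp (fun _ _ => lexx _))) => q Fq.
    by case: F0; exists q.
  pose m v := inf [set sval q v | q in F].
  have m_le (q : T) v : F q -> D v -> m v <= sval q v.
    move=> Fq Dv; apply: ge_inf; last by exists q.
    exists (- p (- v)) => _ [q' _ <-].
    have [s' p'] := svalP q'; have := sublinear_ge s' Dv.
    by have := p' _ (DN Dv); lra.
  have m_ge v c : (forall q : T, F q -> c <= sval q v) -> c <= m v.
    move=> h; apply: lb_le_inf => [|_ [q Fq <-]]; last exact: h.
    by exists (sval q0 v), q0.
  have sm : sublinear m.
    split=> [v w Dv Dw|t v t0 Dv].
      rewrite -lerBlDr; apply: (m_ge) => q1 Fq1.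
      rewrite lerBlDr -lerBlDl; apply: (m_ge) => q2 Fq2.
      rewrite lerBlDr.
      have [/asboolP q12|/asboolP q21] := totF _ _ Fq1 Fq2.
        have := m_le _ _ Fq2 (DD Dv Dw); have := (svalP q2).1.1 _ _ Dv Dw.
        by have := q12 _ Dv; lra.
      have := m_le _ _ Fq1 (DD Dv Dw); have := (svalP q1).1.1 _ _ Dv Dw.
      by have := q21 _ Dw; lra.
    have [->|tn0] := eqVneq t 0.
      have := m_le _ _ Fq0 (DZ 0 Dv); rewrite (sublinearZ (svalP q0).1)//.
      by rewrite !mul0r.
    have t_gt0 : 0 < t by rewrite lt0r tn0.
    rewrite -ler_pdivrMl//; apply: m_ge => q Fq; rewrite ler_pdivrMl//.
    by rewrite -(sublinearZ (svalP q).1)//; apply: m_le => //; exact: DZ.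
  have mp v : D v -> m v <= p v.
    by move=> Dv; apply: le_trans (m_le _ _ Fq0 Dv) ((svalP q0).2 _ Dv).
  by exists (exist _ m (conj sm mp)) => q Fq; apply/asboolP => v Dv /=; exact: m_le.
- exists q; split=> // q' sq' q'q.
  have q'p v : D v -> q' v <= p v.
    by move=> Dv; exact: le_trans (q'q _ Dv) (qp _ Dv).
  have /asboolP := qmin (exist _ q' (conj sq' q'p)) (introT (asboolP _) q'q).
  exact.
Qed.

(** Starting the minimization from the functional that is already additive
    along v0 forces the value at v0. *)
Theorem hahn_banach p v0 : sublinear p -> D v0 ->
  exists L : V -> R,
    [/\ forall v w, D v -> D w -> L (v + w) = L v + L w,
        forall (t : R) v, D v -> L (t *: v) = t * L v,
        forall v, D v -> L v <= p v
      & L v0 = p v0].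
Proof.
move=> sp Dv0.
have [L [sL Lp Lmin]] := sublinear_minimal_ex (sublinear_shift_sublinear sp Dv0).
have LD v w : D v -> D w -> L (v + w) = L v + L w.
  by move=> Dv Dw; apply: sublinear_minimal_additive.
have L0 : L 0 = 0.
  have D0 : D 0 by rewrite -(subrr v0); exact: DD Dv0 (DN Dv0).
  by have := LD _ _ D0 D0; rewrite addr0; lra.
have LN v : D v -> L (- v) = - L v.
  by move=> Dv; have := LD _ _ Dv (DN Dv); rewrite subrr L0; lra.
have Lp' v : D v -> L v <= p v.
  by move=> Dv; apply: le_trans (Lp _ Dv) _; exact: sublinear_shift_le_id.
exists L; split=> // [t v Dv|].
  have [t0|t0] := leP 0 t; first exact: sublinearZ.
  have Nt0 : 0 <= - t by rewrite oppr_ge0 ltW.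
  have := sublinearZ sL Nt0 Dv; rewrite scaleNr LN; last exact: DZ.
  by rewrite mulNr => /oppr_inj.
apply/eqP; rewrite eq_le Lp'//=.
have := le_trans (Lp _ (DN Dv0)) (sublinear_shift_le sp Dv0 (DN Dv0) ler01).
rewrite LN// scale1r addNr mul1r -(scale0r v0) sublinearZ//; lra.
Qed.

End HahnBanach.

(** * The Choquet boundary *)

(** Real parts replace moduli here: unlike peaking functions, these functions
    can be added and rescaled, while g |-> 1 / (1 + N g) turns them into peaking
    functions. *)
Definition weak_peak_set (R : realType) (X : topologicalType)
    (A : set (X -> R[i])) (F : set X) : Prop :=
  forall (U : set X) (e : R), open U -> F `<=` U -> 0 < e ->
  exists2 g, A g & [/\ forall z, 0 <= Re (g z),
    forall z, F z -> Re (g z) <= e & forall z, ~ U z -> 1 <= Re (g z)].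

Definition has_peaks (R : realType) (X : topologicalType)
    (A : set (X -> R[i])) (x : X) : Prop :=
  forall (U : set X) (e : R), open U -> U x -> 0 < e ->
  exists2 k, A k & [/\ forall z, normc (k z) <= 1,
    1 - e <= normc (k x) & forall z, ~ U z -> normc (k z) <= e].

Definition bounded_fun (R : realType) (X : Type) (v : X -> R) :=
  exists M : R, forall z, `|v z| <= M.

Section PositiveFunctional.
Variables (R : realType) (X : Type).
Implicit Types (v w : X -> R).

Lemma bounded_funD v w : bounded_fun v -> bounded_fun w ->
  bounded_fun (fun z => v z + w z).
Proof.
move=> [M vM] [N wN]; exists (M + N) => z.
by rewrite (le_trans (ler_normD _ _))// lerD.
Qed.

Lemma bounded_funM v w : bounded_fun v -> bounded_fun w ->
  bounded_fun (fun z => v z * w z).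
Proof.
by move=> [M vM] [N wN]; exists (M * N) => z; rewrite normrM ler_pM.
Qed.

Lemma bounded_fun_cst (t : R) : bounded_fun (fun _ : X => t).
Proof. by exists `|t|. Qed.

Lemma bounded_funZ (t : R) v : bounded_fun v -> bounded_fun (fun z => t * v z).
Proof. by move=> bv; apply: bounded_funM => //; exact: bounded_fun_cst. Qed.

Record positive_functional (L : (X -> R) -> R) : Prop := PositiveFunctional {
  posD : forall v w, bounded_fun v -> bounded_fun w ->
    L (fun z => v z + w z) = L v + L w;
  posZ : forall (t : R) v, bounded_fun v -> L (fun z => t * v z) = t * L v;
  pos_le0 : forall v, bounded_fun v -> (forall z, v z <= 0) -> L v <= 0 }.

Lemma pos_mono L v w : positive_functional L -> bounded_fun v -> bounded_fun w ->
  (forall z, v z <= w z) -> L v <= L w.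
Proof.
move=> pL bv bw vw; have bNw := bounded_funZ (-1) bw.
have := pos_le0 pL (bounded_funD bv bNw); rewrite (posD pL)// (posZ pL)//.
by move=> /(_ (ltac:(move=> z; have := vw z; lra))); lra.
Qed.

End PositiveFunctional.

Section Choquet.
Variables (R : realType) (X : topologicalType).
Hypothesis Xcompact : compact [set: X].
Hypothesis X0 : [set: X] !=set0.
Variable A : set (X -> R[i]).
Hypothesis uA : uniform_algebra A.
Implicit Types (f g h : X -> R[i]) (v w : X -> R).

Let bounded_Re f : A f -> bounded_fun (fun z => Re (f z)).
Proof.
move=> /(ualg_bounded Xcompact X0 uA)[M _ fM]; exists M => z.
exact: le_trans (norm_Re_le _) (fM z).
Qed.

Let bounded_Im f : A f -> bounded_fun (fun z => Im (f z)).
Proof.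
move=> /(ualg_bounded Xcompact X0 uA)[M _ fM]; exists M => z.
exact: le_trans (norm_Im_le _) (fM z).
Qed.

(** The infimum of Re f(x) over the f in A with v <= Re f is sublinear in v. A
    linear functional below it is positive and represents x on A; by the
    Hahn-Banach theorem it may be made to attain the infimum at v0. All bounded
    functions are admitted, so that v0 can be an indicator function. *)
Lemma representing_functional_ex x v0 : bounded_fun v0 ->
  exists L, [/\ positive_functional L,
    forall f, A f -> L (fun z => Re (f z)) = Re (f x) &
    forall c : R, (forall f, A f -> (forall z, v0 z <= Re (f z)) -> c <= Re (f x)) ->
      c <= L v0].
Proof.
move=> bv0; pose D : set (X -> R^o) := [set v | bounded_fun v].
pose S v : set R := [set Re (f x) | f in [set f | A f /\ forall z, v z <= Re (f z)]].
pose p v : R := inf (S v).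
have S0 v : bounded_fun v -> S v !=set0.
  move=> [M vM]; exists M, (cst M%:C) => //; split; first exact: (ualg_cst uA).
  by move=> z /=; exact: le_trans (ler_norm _) (vM z).
have p_le v f : bounded_fun v -> A f -> (forall z, v z <= Re (f z)) ->
    p v <= Re (f x).
  move=> [M vM] Af vf; apply: ge_inf; last by exists f.
  exists (- M) => _ [g [Ag vg] <-]; apply: le_trans (vg x).
  by have := vM x; rewrite ler_norml => /andP[].
have p_ge v (c : R) : bounded_fun v ->
    (forall f, A f -> (forall z, v z <= Re (f z)) -> c <= Re (f x)) -> c <= p v.
  move=> bv h; apply: lb_le_inf => [|_ [f [Af vf] <-]]; first exact: S0.
  exact: h.
have DD v w : D v -> D w -> D (v + w) by exact: bounded_funD.
have DZ (t : R) v : D v -> D (t *: v) by exact: bounded_funZ.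
have sp : sublinear D p.
  split=> [v w Dv Dw|t v t0 Dv].
    rewrite -lerBlDr; apply: (p_ge) => // f Af vf.
    rewrite lerBlDr -lerBlDl; apply: (p_ge) => // g Ag wg.
    rewrite lerBlDl -ReD; apply: (p_le _ (f + g)) => //.
    - exact: DD.
    - exact: (ualg_add uA).
    - by move=> z; rewrite !fctE ReD lerD.
  have scale_le f : A f -> (forall z, v z <= Re (f z)) ->
      p (t *: v) <= t * Re (f x).
    move=> Af vf; have -> : t * Re (f x) = Re ((cst t%:C * f) x).
      by rewrite !fctE !ReImE /= mul0r subr0.
    apply: p_le; [exact: DZ|exact: ualg_scale|move=> z].
    by rewrite !fctE !ReImE /= mul0r subr0; exact: ler_wpM2l.
  have [t00|tn0] := eqVneq t 0.
    have [_ [f [Af vf] _]] := S0 _ Dv.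
    by have := scale_le f Af vf; rewrite t00 !mul0r.
  have t_gt0 : 0 < t by rewrite lt0r tn0.
  rewrite -ler_pdivrMl//; apply: p_ge => // f Af vf; rewrite ler_pdivrMl//.
  exact: scale_le.
have [L [LD LZ Lp Lv0]] := hahn_banach DD DZ sp bv0.
have Lf f : A f -> L (fun z => Re (f z)) <= Re (f x).
  move=> Af; apply: le_trans (Lp _ (bounded_Re Af)) _.
  by apply: p_le => //; exact: bounded_Re.
exists L; split.
- split=> // v bv v0'; apply: le_trans (Lp _ bv) _.
  by have := p_le v 0 bv (ualg_cst uA 0); apply.
- move=> f Af; apply/eqP; rewrite eq_le Lf//=.
  have := Lf _ (ualg_opp uA Af); rewrite !fctE ReN.
  rewrite (_ : (fun z => Re (- f z)) = (-1 : R) *: (fun z => Re (f z) : R^o)).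
    by rewrite LZ; [lra|exact: bounded_Re].
  by apply/funext => z; rewrite /= ReN [RHS]mulN1r.
- by move=> c h; rewrite Lv0; exact: p_ge.
Qed.

Section Weighted.
Variables (L : (X -> R) -> R) (w : X -> R).
Hypothesis pL : positive_functional L.
Hypothesis bw : bounded_fun w.
Hypothesis w0 : forall z, 0 <= w z.
Hypothesis Lw : 0 < L w.

Definition weighted_state f : R[i] :=
  ((L w)^-1 * L (fun z => w z * Re (f z))) +i*
  ((L w)^-1 * L (fun z => w z * Im (f z))).

Lemma state_weighted_state : state A weighted_state.
Proof.
have wRe f : A f -> bounded_fun (fun z => w z * Re (f z)).
  by move=> /bounded_Re; exact: bounded_funM.
have wIm f : A f -> bounded_fun (fun z => w z * Im (f z)).
  by move=> /bounded_Im; exact: bounded_funM.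
have lin (a : R[i]) f g : A f -> A g ->
    weighted_state (cst a * f + g) = a * weighted_state f + weighted_state g.
  move=> Af Ag; rewrite /weighted_state.
  rewrite (_ : (fun z => w z * Re ((cst a * f + g) z)) =
    (fun z => (Re a * (w z * Re (f z)) + - Im a * (w z * Im (f z))) +
              w z * Re (g z))); last first.
    by apply/funext => z; rewrite !fctE !ReImE; ring.
  rewrite (_ : (fun z => w z * Im ((cst a * f + g) z)) =
    (fun z => (Re a * (w z * Im (f z)) + Im a * (w z * Re (f z))) +
              w z * Im (g z))); last first.
    by apply/funext => z; rewrite !fctE !ReImE; ring.
  rewrite !(posD pL) ?(posZ pL); do ?[exact: wRe|exact: wIm|
    exact: bounded_funZ (wRe _ Af)|exact: bounded_funZ (wIm _ Af)|
    apply: bounded_funD].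
  case: a => a b /=; simpc; congr (_ +i* _); ring.
split=> // [f Af|]; last first.
  rewrite /weighted_state.
  rewrite (_ : (fun z => w z * Re ((1 : X -> R[i]) z)) = w); last first.
    by apply/funext => z; rewrite /= mulr1.
  rewrite (_ : (fun z => w z * Im ((1 : X -> R[i]) z)) = (fun z => 0 * w z)).
    by rewrite (posZ pL)// mul0r mulr0 mulVf// gt_eqF.
  by apply/funext => z; rewrite /= mulr0 mul0r.
have [a a1 af] := normc_rotate (weighted_state f).
have A0 : A 0 := ualg_cst uA 0.
have ws0 : weighted_state 0 = 0.
  have := lin 1 0 0 A0 A0; rewrite (_ : cst 1 * 0 + 0 = 0).
    by rewrite [X in _ = X + _]mul1r => /eqP; rewrite -subr_eq subrr => /eqP.
  by apply/funext => z; rewrite !fctE mul1r addr0.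
have := congr1 (@complex.Re R) (lin a f 0 Af A0).
rewrite addr0 ws0 addr0 af => nE.
have -> : normc (weighted_state f) =
  (L w)^-1 * L (fun z => w z * Re ((cst a * f) z)) by exact: esym nE.
rewrite ler_pdivrMl//.
have -> : L w * supnorm f = L (fun z => supnorm f * w z) by rewrite (posZ pL)// mulrC.
apply: (pos_mono pL).
- by apply: wRe; exact: ualg_scale.
- exact: bounded_funZ.
- move=> z; rewrite mulrC; apply: ler_wpM2r => //.
  rewrite (le_trans (Re_le_normc _))// !fctE normcM a1 mul1r.
  exact: (supnorm_ub Xcompact X0 uA).
Qed.

End Weighted.


(** The functional L splits as the sum of its multiples by w and by 1 - w; both
    restrict to multiples of states, so extremality of the evaluation at x
    makes L multiplicative enough to vanish on squares of functions Re h with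
    h(x) = 0. The weight w = 1/2 + c Re h has mass exactly 1/2, because
    h(x) = 0, and a small c keeps w and 1 - w nonnegative. *)
Lemma representing_functional_square L x h : choquet_boundary A x ->
  positive_functional L -> (forall f, A f -> L (fun z => Re (f z)) = Re (f x)) ->
  A h -> h x = 0 -> L (fun z => Re (h z) * Re (h z)) = 0.
Proof.
move=> [_ ext] pL Lf Ah hx0.
have [M M1 hM] := ualg_bounded Xcompact X0 uA Ah.
have M0 : 0 < M by lra.
(* c is chosen so that |c Re h| <= 1/4 *)
pose c := (4 * M)^-1; have c0 : 0 < c by rewrite invr_gt0 mulr_gt0.
have cM : c * M = 4^-1 by rewrite /c invfM -mulrA mulVf ?gt_eqF// mulr1.
have bh := bounded_Re Ah.
have ch z : `|c * Re (h z)| <= 4^-1.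
  rewrite normrM (gtr0_norm c0) -cM ler_pM2l//.
  exact: le_trans (norm_Re_le _) (hM z).
pose w (s : R) z := 2^-1 + s * Re (h z).
have L1 : L (fun=> 1) = 1.
  have := Lf _ (ualg_1 uA).
  by rewrite (_ : (fun z => Re ((1 : X -> R[i]) z)) = fun=> 1).
have bw s : bounded_fun (w s).
  by apply: bounded_funD; [exact: bounded_fun_cst|exact: bounded_funZ].
have Lw s : L (w s) = 2^-1.
  rewrite (posD pL); [|exact: bounded_fun_cst|exact: bounded_funZ].
  rewrite (posZ pL)// Lf// hx0 mulr0 addr0.
  rewrite -[RHS]mulr1 -[X in _ = _ * X]L1 -(posZ pL); last exact: bounded_fun_cst.
  by congr L; apply/funext => z; rewrite mulr1.
have w0 z : 0 <= w c z by have := ch z; rewrite /w ler_norml; lra.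
have w0' z : 0 <= w (- c) z by have := ch z; rewrite /w mulNr ler_norml; lra.
have Lw0 s : 0 < L (w s) by rewrite Lw; lra.
have LIm f : A f -> L (fun z => Im (f z)) = Im (f x).
  move=> Af; have := Lf _ (ualg_scale uA (- 'i) Af).
  rewrite (_ : (fun z => Re _) = (fun z => Im (f z))).
    by move=> ->; rewrite !fctE !ReImE /=; ring.
  by apply/funext => z; rewrite !fctE !ReImE /=; ring.
have t01 : 0 < (2^-1 : R) < 1 by apply/andP; split; lra.
have mean f : A f -> f x = (2^-1)%:C * weighted_state L (w c) f +
    (1 - 2^-1)%:C * weighted_state L (w (- c)) f.
  move=> Af; have -> : 1 - 2^-1 = 2^-1 :> R by lra.
  have mean v : bounded_fun v ->
      2^-1 * ((2^-1)^-1 * L (fun z => w c z * v z)) +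
      2^-1 * ((2^-1)^-1 * L (fun z => w (- c) z * v z)) = L v.
    move=> bv; rewrite !mulrA mulfV ?mul1r; last by rewrite invr_eq0 pnatr_eq0.
    rewrite -(posD pL); try exact: bounded_funM.
    by congr L; apply/funext => z; rewrite -mulrDl /w; lra.
  have := mean _ (bounded_Re Af); have := mean _ (bounded_Im Af).
  rewrite LIm// Lf// /weighted_state !Lw.
  by case: (f x) => a b /= <- <-; simpc.
have [E _] := ext _ _ _ (state_weighted_state pL (bw c) w0 (Lw0 c))
  (state_weighted_state pL (bw (- c)) w0' (Lw0 (- c))) t01 mean h Ah.
have /eqP := congr1 (@complex.Re R) E.
rewrite hx0 /= Lw mulf_eq0 !invr_eq0 pnatr_eq0 /= => /eqP.
rewrite (_ : (fun z => _) =
  fun z => 2^-1 * Re (h z) + c * (Re (h z) * Re (h z))); last first.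
  by apply/funext => z; rewrite /w; ring.
have bhh := bounded_funM bh bh.
rewrite (posD pL); [|exact: bounded_funZ|exact: bounded_funZ].
rewrite !(posZ pL)// Lf// hx0 mulr0 add0r => /eqP.
by rewrite mulf_eq0 (gt_eqF c0) => /eqP.
Qed.

(** If no real part of a function of A separates x from the complement of U
    well enough, a functional representing x gives mass to that complement; but
    it kills finitely many squares that together exceed 1 there. *)
Theorem choquet_weak_peak x : choquet_boundary A x -> weak_peak_set A [set x].
Proof.
move=> chx U e oU xU e0.
pose v0 z : R := if `[< U z >] then 0 else 1.
have bv0 : bounded_fun v0.
  by exists 1 => z; rewrite /v0; case: asboolP; rewrite ?normr0 ?normr1.
have [L [pL Lf Lv0]] := representing_functional_ex x bv0.
suff Lv00 : L v0 <= 0.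
  apply: contrapT => ng; suff : e <= L v0 by lra.
  apply: Lv0 => f Af vf; rewrite leNgt; apply/negP => fe; apply: ng.
  exists f => //; split=> [z|_ ->|z Uz].
  - by apply: le_trans (vf z); rewrite /v0; case: asboolP.
  - exact: ltW.
  - by apply: le_trans (vf z); rewrite /v0; case: asboolP.
(* the cone Q is stable under sums, so its sublevel sets are directed *)
pose Q : set (X -> R) := [set u | [/\ bounded_fun u, continuous u,
  forall z, 0 <= u z & L u <= 0]].
have [u [bu cu u0 Lu] u1] : exists2 u, Q u & forall z, ~ U z -> 1 <= u z.
  apply: contrapT => nQ.
  have cU : compact (~` U).
    by apply: (subclosed_compact _ Xcompact) => //; exact: open_closedC.
  have [|u|u v|u Qu|z Uz uz] :=
    @compact_directed X _ Q (fun u => [set z | u z <= 1]) _ cU.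
  - exists (fun=> 0); split => //; first exact: bounded_fun_cst.
      exact: cst_continuous.
    by apply: (pos_le0 pL) => //; exact: bounded_fun_cst.
  - by case=> _ cu _ _; exact: closed_le_level.
  - move=> [bu cu u0 Lu] [bv cv v0' Lv]; exists (fun z => u z + v z).
      split; first exact: bounded_funD.
      + by move=> z; apply: cvgD; [exact: cu|exact: cv].
      + by move=> z; exact: addr_ge0.
      + by rewrite (posD pL)//; lra.
    by move=> z [_ /= uv]; have := u0 z; have := v0' z; split => /=; lra.
  - apply: contrapT => /nonemptyPn uU; apply: nQ; exists u => // z Uz.
    rewrite leNgt; apply/negP => /ltW uz.
    by suff : set0 z by []; rewrite -uU.
  have zx : z <> x by move=> zx; apply: Uz; rewrite zx; exact: xU.
  have [f Af fzx] := ualg_separates uA zx.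
  have d0 : f z - f x != 0 by rewrite subr_eq0; exact/eqP.
  have [h [Ah hx hz]] : exists h, [/\ A h, h x = 0 & h z = 2].
    exists (cst (2 / (f z - f x)) * (f - cst (f x))); split.
    - by apply: ualg_scale => //; exact: ualg_subc.
    - by rewrite !fctE subrr mulr0.
    - by rewrite !fctE divfK.
  have bh := bounded_Re Ah; have ch := continuous_Re uA Ah.
  suff Qh : Q (fun z => Re (h z) * Re (h z)).
    have : Re (h z) * Re (h z) <= 1 := uz _ Qh.
    by rewrite hz /=; lra.
  split.
  - exact: bounded_funM.
  - by move=> y; apply: cvgM; exact: ch.
  - by move=> y; exact: sqr_ge0.
  - by rewrite (representing_functional_square chx pL Lf Ah hx).
apply: le_trans Lu; apply: (pos_mono pL) => // z.
by rewrite /v0; case: asboolP => [_|/u1].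
Qed.

End Choquet.

Section Peaks.
Variables (R : realType) (X : topologicalType).
Hypothesis Xcompact : compact [set: X].
Hypothesis X0 : [set: X] !=set0.
Variable A : set (X -> R[i]).
Hypothesis uA : uniform_algebra A.
Implicit Types (f g h k u : X -> R[i]).

(** The transform 1 / (1 + N g) maps the half-plane of nonnegative real parts
    into the unit disc, and its values are invertible by a Neumann series. A
    large N makes it small where Re g >= 1. *)
Lemma weak_peak_invertible x (U : set X) (e : R) : weak_peak_set A [set x] ->
  open U -> U x -> 0 < e ->
  exists2 k, invertibles A k & [/\ forall z, normc (k z) <= 1,
    1 - e <= normc (k x) & forall z, ~ U z -> normc (k z) <= e].
Proof.
move=> wx oU Ux e0; pose N := e^-1; have N0 : 0 < N by rewrite invr_gt0.
have [|//|g Ag [g0 gx gU]] := wx U (e / N) oU; first by move=> _ ->.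
  by rewrite divr_gt0.
have [u [Au uE ux]] : exists u,
    [/\ A u, forall z, Re (u z) = N * Re (g z) & Im (u x) = 0].
  exists (cst N%:C * (g - cst (0 +i* Im (g x)))); split=> [|z|].
  - by apply: (ualg_scale uA); exact: (ualg_subc uA).
  - by rewrite !fctE !ReImE /= mul0r !subr0.
  - by rewrite !fctE !ReImE /= subrr mul0r mulr0 addr0.
have u0 z : 0 <= Re (u z) by rewrite uE mulr_ge0// ltW.
have I1 := invertibles_1D Xcompact X0 uA Au u0.
have nE z : normc (fun_inv (1 + u) z) = (normc (1 + u z))^-1.
  by rewrite /fun_inv normcV.
have nge z : 1 + N * Re (g z) <= normc (1 + u z).
  by have := Re_le_normc (1 + u z); rewrite ReD uE.
have n1 z : 1 <= normc (1 + u z).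
  by apply: le_trans (nge z); rewrite lerDl -uE.
have npos z : 0 < normc (1 + u z) by exact: lt_le_trans (n1 z).
exists (fun_inv (1 + u)); first exact: invertibles_inv.
split=> [z||z Uz]; rewrite nE.
- by rewrite invf_le1.
- have Nx : N * Re (g x) <= e.
    by have := gx x erefl; rewrite ler_pdivlMr// mulrC.
  have -> : normc (1 + u x) = 1 + N * Re (g x).
    rewrite normcE !ReImE ux uE /= addr0 expr0n addr0 sqrtr_sqr ger0_norm//.
    by rewrite addr_ge0// -uE.
  rewrite -[_^-1]mul1r ler_pdivlMr; last by rewrite ltr_wpDr// -uE.
  have : 0 <= N * Re (g x) by rewrite -uE.
  move: (N * Re _) Nx => s; nra.
- rewrite -[e]invrK lef_pV2 ?posrE//; apply: le_trans (nge z).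
  have := gU z Uz; rewrite -/N => gz.
  by rewrite -[X in X <= _]mulr1 (le_trans (ler_wpM2l (ltW N0) gz))// lerDr.
Qed.

Let eval_state x : state A (fun f => f x).
Proof.
by split=> [//|f Af|//]; exact: (supnorm_ub Xcompact X0 uA).
Qed.

(** If the evaluation at x is a mean of L1 and L2, then both are close to 1 on a
    function h peaking at x. For f0 vanishing at x, b f0 + 2 M h has norm close
    to 2 M for each unimodular b, since f0 is small near x and h is small
    elsewhere; this leaves no room for L1 f0. *)
Lemma has_peaks_extreme x (L1 L2 : (X -> R[i]) -> R[i]) (t : R) f :
  has_peaks A x -> state A L1 -> state A L2 -> 0 < t < 1 ->
  (forall f, A f -> f x = t%:C * L1 f + (1 - t)%:C * L2 f) ->
  A f -> L1 f = f x.
Proof.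
move=> px [lin1 n1 L11] [lin2 n2 L21] /andP[t0 t1] mean Af.
pose f0 := f - cst (f x).
have Af0 : A f0 := ualg_subc uA _ Af.
have L1f0 : L1 f0 = L1 f - f x.
  have := lin1 (- f x) 1 f (ualg_1 uA) Af.
  rewrite L11 [X in _ = X + _]mulr1 [RHS]addrC => <-; congr L1; apply/funext => z.
  by rewrite /f0 !fctE mulr1 addrC.
have [M M1 fM] := ualg_bounded Xcompact X0 uA Af0.
apply: (@eq_of_normc_small R) => d d0; rewrite -L1f0.
have bound (e : R) : 0 < e -> e <= 2^-1 -> normc (L1 f0) <= e + 2 * M * (e / t).
  move=> e0 e2.
  have [||//|k Ak [k1 kx kU]] := px [set z | normc (f0 z) < e] e.
    by apply: open_lt_level; exact: (continuous_norm uA Af0).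
    by rewrite /f0 /= !fctE subrr normc0.
  have [a a1 akx] := normc_rotate (k x).
  pose h := cst a * k; have Ah : A h := ualg_scale uA a Ak.
  have hn z : normc (h z) = normc (k z) by rewrite /h !fctE normcM a1 mul1r.
  have hs : supnorm h <= 1 by apply: supnorm_le => // z; rewrite hn.
  have Reh : 1 - e / t <= Re (L1 h).
    have := congr1 (@complex.Re R) (mean h Ah); rewrite [h x]akx !ReImE /= !mul0r !subr0.
    have := le_trans (le_trans (Re_le_normc _) (n2 h Ah)) hs.
    move: (Re (L1 h)) (Re (L2 h)) => r1 r2 r21 E.
    have : t - e <= t * r1 by nra.
    have te : t * (e / t) = e by rewrite mulrC divfK// gt_eqF.
    by move=> tr; rewrite -(ler_pM2l t0) mulrBr te; lra.
  have [b b1 bf0] := normc_rotate (L1 f0).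
  pose g := cst b * f0 + cst (2 * M)%:C * h.
  have Ag : A g by apply: (ualg_add uA); exact: ualg_scale.
  have L1g : Re (L1 g) = normc (L1 f0) + 2 * M * Re (L1 h).
    rewrite lin1//; last exact: ualg_scale.
    have := lin1 (2 * M)%:C h 0 Ah (ualg_cst uA 0).
    have -> : L1 0 = 0.
      have := lin1 1 0 0 (ualg_cst uA 0) (ualg_cst uA 0).
      rewrite (_ : cst 1 * 0 + 0 = 0).
        by rewrite mul1r => /eqP; rewrite -subr_eq subrr => /eqP.
      by apply/funext => z; rewrite !fctE mul1r addr0.
    rewrite !addr0 => ->; rewrite bf0 !ReImE /= mul0r subr0 //.
  have gs : supnorm g <= 2 * M + e.
    apply: supnorm_le => // z.
    have -> : g z = b * f0 z + (2 * M)%:C * h z by [].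
    apply: le_trans (normcD _ _) _.
    rewrite (normcM b) (normcM (2 * M)%:C) b1 mul1r normc_real hn ger0_norm; last lra.
    have [zU|zU] := ltP (normc (f0 z)) e.
      by have := k1 z; have := normc_ge0 (k z); nra.
    have := kU z; rewrite /= => /(_ (ltac:(apply/negP; rewrite -leNgt//))).
    by have := fM z; nra.
  have := le_trans (le_trans (Re_le_normc _) (n1 g Ag)) gs.
  rewrite L1g; move: (Re (L1 h)) (e / t) Reh => r1 et; nra.
pose K := 1 + 2 * M / t.
have K1 : 1 <= K by rewrite lerDl divr_ge0 ?mulr_ge0//; lra.
pose e := Num.min (2^-1) (d / K).
have K0 : 0 < K by lra.
have e0 : 0 < e by rewrite lt_min divr_gt0// andbT invr_gt0.
apply: le_trans (bound e e0 _) _; first by rewrite ge_min lexx.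
have -> : e + 2 * M * (e / t) = e * K by rewrite /K; field; rewrite gt_eqF.
by rewrite -ler_pdivlMr// ge_min lexx orbT.
Qed.

Lemma has_peaks_choquet x : has_peaks A x -> choquet_boundary A x.
Proof.
move=> px; split; first exact: eval_state.
move=> L1 L2 t s1 s2 t01 mean f Af; split.
  exact: has_peaks_extreme px s1 s2 t01 mean Af.
apply: (has_peaks_extreme px s2 s1 (t := 1 - t)) => //.
  by move: t01; rewrite subr_gt0 ltrBlDr ltrDl andbC.
by move=> g Ag; rewrite mean// subKr addrC.
Qed.

Lemma weak_peak_choquet x : weak_peak_set A [set x] -> choquet_boundary A x.
Proof.
move=> wx; apply: has_peaks_choquet => U e oU Ux e0.
have [k [Ak _] kP] := weak_peak_invertible wx oU Ux e0.
by exists k.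
Qed.

Lemma weak_peak_setT : weak_peak_set A [set: X].
Proof.
move=> U e _ TU e0; exists 0; first exact: (ualg_cst uA 0).
by split=> [z|z _|z /(_ (TU z I))]//; rewrite ltW.
Qed.

(** On a neighbourhood V of F a large multiple N (f - m) is almost nonnegative,
    and it is at least 1 off U; away from V, where it may be very negative, a
    multiple of a function g obtained from F dominates it. *)
Lemma weak_peak_min F f (m : R) : closed F -> weak_peak_set A F -> A f ->
  (forall z, F z -> m <= Re (f z)) ->
  weak_peak_set A (F `&` [set z | Re (f z) <= m]).
Proof.
move=> clF wF Af fm U e oU FU e0.
pose f0 := f - cst m%:C; have Af0 : A f0 := ualg_subc uA _ Af.
have f0E z : Re (f0 z) = Re (f z) - m by rewrite /f0 !fctE !ReImE.
have cf0 := continuous_Re uA Af0.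
have [d d0 fd] : exists2 d : R, 0 < d & forall z, F z -> ~ U z -> d < Re (f0 z).
  have [[y FUy]|FU0] := pselect ((F `&` ~` U) !=set0); last first.
    by exists 1 => // z Fz Uz; case: FU0; exists z.
  have cFU : compact (F `&` ~` U).
    apply: (subclosed_compact _ Xcompact) => //.
    by apply: closedI => //; exact: open_closedC.
  have [||x [Fx Ux] xmax] := continuous_max_ex cFU (f := fun z => Re ((- f0) z)).
    by exists y.
    by apply: (continuous_Re uA); exact: (ualg_opp uA).
  have fx : 0 < Re (f0 x).
    rewrite f0E subr_gt0 ltNge; apply/negP => fxm; apply: Ux; exact: FU.
  exists (Re (f0 x) / 2) => [|z Fz Uz]; first by rewrite divr_gt0.
  by have := xmax z (conj Fz Uz); rewrite /= !fctE !ReN; lra.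
have [M M1 fM] := ualg_bounded Xcompact X0 uA Af0.
pose N := d^-1; have N0 : 0 < N by rewrite invr_gt0.
have Nd : N * d = 1 by rewrite mulVf// gt_eqF.
pose V := [set z | - (e / 2 / N) < Re (f0 z)] `&` (U `|` [set z | d < Re (f0 z)]).
have NM : 0 < N * M by rewrite mulr_gt0// (lt_le_trans ltr01 M1).
pose K := N * M + 1; have K0 : 0 < K by rewrite ltr_wpDl// ltW.
have [|z Fz||g Ag [g0 gF gV]] := wF V (e / 2 / K).
- by apply: openI; [|apply: openU => //]; exact: open_gt_level.
- have eN : 0 < e / 2 / N by rewrite !divr_gt0.
  split; first by have := fm z Fz; rewrite /= f0E; lra.
  by have [|Uz] := pselect (U z); [left|right; exact: fd].
- by rewrite !divr_gt0.
pose G := cst N%:C * f0 + cst K%:C * g + cst (e / 2)%:C.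
have GE z : Re (G z) = N * Re (f0 z) + K * Re (g z) + e / 2.
  by rewrite /G !fctE !ReImE /= !mul0r !subr0.
exists G.
  by do 2?[apply: (ualg_add uA)]; [exact: ualg_scale|exact: ualg_scale|
    exact: (ualg_cst uA)].
have key z : 0 <= Re (G z) /\ (~ U z -> 1 <= Re (G z)).
  rewrite GE; have gz := g0 z; have Kg : 0 <= K * Re (g z) by nra.
  have [[/= Vz UV]|nV] := pselect (V z).
    have Nf : - (e / 2) <= N * Re (f0 z).
      by rewrite -ler_pdivrMl// mulrN mulrC ltW.
    split; first lra.
    by move=> Uz; case: UV => // /= df; have := ler_wpM2l (ltW N0) (ltW df); lra.
  have := gV z nV => g1; have := norm_Re_le (f0 z); have := fM z.
  rewrite ler_norml => fMz /andP[fn _].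
  have : N * - M <= N * Re (f0 z) by rewrite ler_pM2l//; have := fM z; lra.
  by split; [|move=> _]; rewrite /K in Kg *; nra.
split=> [z|z [Fz /= fz]|z]; [exact: (key z).1| |exact: (key z).2].
rewrite GE; have := gF z Fz; rewrite ler_pdivlMr// mulrC.
have : N * Re (f0 z) <= 0 by rewrite f0E pmulr_rle0//; lra.
lra.
Qed.

(** Minimal closed weak peak sets are singletons, because the minimum set of a
    real part on a weak peak set is again one; hence every maximum set of a
    modulus meets the Choquet boundary. *)
Theorem choquet_max_ex f : A f ->
  exists2 x, choquet_boundary A x & forall z, normc (f z) <= normc (f x).
Proof.
move=> Af; have [x0 x0max] := norm_max_ex Xcompact X0 uA Af.
have [a a1 afx0] := normc_rotate (f x0).
pose h := cst (- a) * f; have Ah : A h := ualg_scale uA (- a) Af.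
pose m := - normc (f x0).
have hm z : m <= Re (h z).
  have := norm_Re_le (h z); rewrite /h !fctE normcM normcNE a1 mul1r.
  by rewrite ler_norml /m; have := x0max z; lra.
have hx0 : Re (h x0) = m by rewrite /h !fctE mulNr afx0.
pose F0 := [set z | Re (h z) <= m].
have clF0 : closed F0 by apply: closed_le_level; exact: (continuous_Re uA).
have wF0 : weak_peak_set A F0.
  have := @weak_peak_min setT h m closedT weak_peak_setT Ah (fun z _ => hm z).
  by rewrite setTI.
pose T := {F : set X | [/\ closed F, F !=set0, weak_peak_set A F & F `<=` F0]}.
have F0P : [/\ closed F0, F0 !=set0, weak_peak_set A F0 & F0 `<=` F0].
  by split=> //; exists x0; rewrite /F0 /= hx0.
pose le (F G : T) := `[< sval G `<=` sval F >].
have [|F|F G H|C totC|[F [clF [x Fx] wF FF0]] Fmin] := @ZL_preorder T _ le.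
- exact: (exist _ F0 F0P).
- exact/asboolP.
- by move=> /asboolP FG /asboolP GH; apply/asboolP; exact: subset_trans GH FG.
- have [[C0 CC0]|C0] := pselect (C !=set0); last first.
    by exists (exist _ F0 F0P) => F CF; case: C0; exists F.
  have sub (D : set X) : compact D -> (forall F, C F -> D `&` sval F !=set0) ->
      exists2 x, D x & forall F, C F -> sval F x.
    move=> cD; apply: compact_directed => //; first by exists C0.
      by move=> F _; have [] := svalP F.
    move=> F G CF CG; have [/asboolP FG|/asboolP GF] := totC _ _ CF CG.
      by exists G => // z [_ Gz]; split=> //; exact: FG.
    by exists F => // z [_ Fz]; split=> //; exact: GF.
  pose I := \bigcap_(F in C) sval F.
  have IP : [/\ closed I, I !=set0, weak_peak_set A I & I `<=` F0].
    split.
    - by apply: closed_bigI => F _; have [] := svalP F.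
    - have [|x _ Ix] := sub _ Xcompact; last by exists x.
      by move=> F _; rewrite setTI; have [] := svalP F.
    - move=> U e oU IU e0.
      have [F CF FU] : exists2 F, C F & sval F `<=` U.
        apply: contrapT => nFU.
        have cU : compact (~` U).
          by apply: (subclosed_compact _ Xcompact) => //; exact: open_closedC.
        have [F CF|x Ux Ix] := sub _ cU; last by apply: Ux; exact: IU.
        apply: contrapT => /nonemptyPn UF; apply: nFU; exists F => // z Fz.
        by apply: contrapT => Uz; suff : set0 z by []; rewrite -UF.
      have [_ _ wF _] := svalP F.
      have [g Ag [g0 gF gU]] := wF U e oU FU e0.
      by exists g => //; split=> // z Iz; apply: gF; exact: Iz.
    - by move=> z Iz; have [_ _ _] := svalP C0; apply; exact: Iz.
  by exists (exist _ I IP) => F CF; apply/asboolP => z; apply.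
have cF : compact F by exact: (subclosed_compact clF Xcompact).
(* the minimum set of Re g on F is a smaller weak peak set, hence equal to F *)
have Fconst g y : A g -> F y -> Re (g y) <= Re (g x).
  move=> Ag Fy.
  have [||z Fz zmax] := continuous_max_ex cF (f := fun z => Re ((- g) z)).
  - by exists x.
  - by apply: (continuous_Re uA); exact: (ualg_opp uA).
  pose G := F `&` [set y | Re (g y) <= Re (g z)].
  have gz y' : F y' -> Re (g z) <= Re (g y').
    by move=> /zmax; rewrite /= !fctE !ReN lerN2.
  have GP : [/\ closed G, G !=set0, weak_peak_set A G & G `<=` F0].
    split; last by move=> y' [/FF0].
    - by apply: closedI => //; apply: closed_le_level; exact: (continuous_Re uA).
    - by exists z; split=> /=.
    - exact: weak_peak_min.
  have /asboolP FG := Fmin (exist _ G GP) (introT (asboolP (G `<=` F)) (fun y' Gy => Gy.1)).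
  by have [_ /= gy] := FG y Fy; apply: le_trans gy (gz x Fx).
have FE : F = [set x].
  apply/seteqP; split=> [y Fy|_ ->//]; apply: contrapT => yx.
  have [g Ag] := ualg_separates uA yx; apply.
  have Reeq k : A k -> Re (k y) = Re (k x).
    move=> Ak; apply/eqP; rewrite eq_le Fconst//=.
    by have := Fconst _ _ (ualg_opp uA Ak) Fy; rewrite !fctE !ReN lerN2.
  have := Reeq _ (ualg_scale uA (- 'i) Ag); have := Reeq _ Ag.
  rewrite !fctE !ReImE /=; case: (g x) (g y) => a1' b1 [a2 b2] /= -> E.
  by congr (_ +i* _); lra.
exists x; first by apply: weak_peak_choquet; rewrite -FE.
move=> z; apply: le_trans (x0max z) _.
have := FF0 x Fx; rewrite /F0 /= /m => hx.
have := norm_Re_le (h x); rewrite {2}/h !fctE normcM normcNE a1 mul1r.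
by rewrite ler_norml; lra.
Qed.

End Peaks.

(** * Invertible functions peaking at a point of the Choquet boundary *)

(** The sequences of nested intervals a n - 2 C / 2 ^ n, a n + 2 C / 2 ^ n
    give both the limit and the rate of convergence. *)
Lemma geometric_limit (R : realType) (a : nat -> R) (C : R) :
  (forall n, `|a n.+1 - a n| <= C * 2^-1 ^+ n) ->
  exists l, forall n, `|l - a n| <= 2 * C * 2^-1 ^+ n.
Proof.
move=> aC; pose d n := 2 * C * 2^-1 ^+ n.
have d2 n : d n.+1 = d n - C * 2^-1 ^+ n by rewrite /d exprS; lra.
have C0 : 0 <= C by have := le_trans (normr_ge0 _) (aC 0); rewrite expr0 mulr1.
have d0 n : 0 <= d n by rewrite !mulr_ge0// exprn_ge0.
have step n : a n - d n <= a n.+1 - d n.+1 /\ a n.+1 + d n.+1 <= a n + d n.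
  by have := aC n; rewrite d2 ler_norml => /andP[]; rewrite /d; lra.
have lo n k : a n - d n <= a (n + k)%N - d (n + k)%N.
  elim: k => [|k IH]; first by rewrite addn0.
  by rewrite addnS; apply: le_trans IH (step _).1.
have hi n k : a (n + k)%N + d (n + k)%N <= a n + d n.
  elim: k => [|k IH]; first by rewrite addn0.
  by rewrite addnS; apply: le_trans (step _).2 IH.
have lohi m n : a m - d m <= a n + d n.
  have := lo m n; have := hi n m; rewrite [(n + m)%N]addnC.
  by have := d0 (m + n)%N; lra.
exists (sup (range (fun n => a n - d n))) => n.
have h1 : a n - d n <= sup (range (fun n => a n - d n)).
  apply: ub_le_sup; last by exists n.
  by exists (a 0 + d 0) => _ [m _ <-]; exact: lohi.
have h2 : sup (range (fun n => a n - d n)) <= a n + d n.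
  by apply: sup_le_ub => [|_ [m _ <-]]; [exists (a 0 - d 0), 0%N|exact: lohi].
by rewrite ler_norml -/(d n); lra.
Qed.

Section PeakingFunctions.
Variables (R : realType) (X : topologicalType).
Hypothesis Xcompact : compact [set: X].
Hypothesis X0 : [set: X] !=set0.
Variable A : set (X -> R[i]).
Hypothesis uA : uniform_algebra A.
Implicit Types (f g h k u : X -> R[i]).

(** Add to 1 a small multiple of a function that vanishes at x and is negative
    at y. *)
Lemma invertibles_separate x y : x <> y ->
  exists2 a, invertibles A a & a x = 1 /\ normc (a y) < 1.
Proof.
move=> xy; have [f Af fxy] := ualg_separates uA xy.
have d0 : f y - f x != 0 by rewrite subr_eq0; apply/eqP => /esym.
have [k [Ak kx ky]] : exists k, [/\ A k, k x = 0 & k y = 1].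
  exists (cst (f y - f x)^-1 * (f - cst (f x))); split.
  - by apply: (ualg_scale uA); exact: (ualg_subc uA).
  - by rewrite !fctE subrr mulr0.
  - by rewrite !fctE mulVf.
have [M M1 kM] := ualg_bounded Xcompact X0 uA Ak.
pose c : R := (2 * M)^-1; have c0 : 0 < c by rewrite invr_gt0; lra.
have cM : c * M = 2^-1 by rewrite /c invfM -mulrA mulVf ?mulr1// gt_eqF//; lra.
have c1 : c <= 2^-1 by nra.
exists (1 - cst c%:C * k).
  apply: (invertibles_neumann X0 uA (r := 2^-1)).
  - exact: (ualg_scale uA).
  - lra.
  - by move=> z; rewrite !fctE normcM normc_real gtr0_norm// -cM ler_pM2l.
split; first by rewrite !fctE kx mulr0 subr0.
have -> : (1 - cst c%:C * k) y = (1 - c)%:C.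
  by rewrite !fctE ky mulr1 rmorphB rmorph1.
by rewrite normc_real ger0_norm; lra.
Qed.

Lemma invertibles_lower_bound f : invertibles A f ->
  exists2 c : R, 0 < c & forall z, c <= normc (f z).
Proof.
move=> If; have [Ai _] := invertibles_inv If.
have [M M1 fM] := ualg_bounded Xcompact X0 uA Ai.
have M0 : 0 < M by lra.
exists M^-1 => [|z]; first by rewrite invr_gt0.
have fz : 0 < normc (f z) by rewrite normc_gt0 (invertibles_neq0 _ If).
have := fM z; rewrite /fun_inv normcV -lef_pV2 ?posrE ?invr_gt0//.
by rewrite invrK.
Qed.

(** Off a neighbourhood of x the two given functions are bounded below, and a
    peaking function is uniformly small there. *)
Lemma dominated_peak x f1 f2 (s : R) : choquet_boundary A x ->
  invertibles A f1 -> invertibles A f2 -> 0 < s ->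
  s < normc (f1 x) -> s < normc (f2 x) ->
  exists2 k, invertibles A k & [/\ forall z, normc (k z) <= normc (f1 z),
    forall z, normc (k z) <= normc (f2 z) & s < normc (k x)].
Proof.
move=> chx I1 I2 s0 s1 s2; have wx := choquet_weak_peak Xcompact X0 uA chx.
pose m := Num.min (normc (f1 x)) (normc (f2 x)).
have sm : s < m by rewrite lt_min s1.
pose r := (m + s) / 2; have sr : s < r by rewrite /r; lra.
have rm : r < m by rewrite /r; lra.
have r0 : 0 < r by lra.
have [r1 r2] : r < normc (f1 x) /\ r < normc (f2 x).
  by move: rm; rewrite lt_min => /andP[].
have [c1 c10 f1c] := invertibles_lower_bound I1.
have [c2 c20 f2c] := invertibles_lower_bound I2.
pose c := Num.min c1 c2; have c0 : 0 < c by rewrite lt_min c10.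
pose e := Num.min (c / r) ((r - s) / (2 * r)).
have e0 : 0 < e by rewrite lt_min !divr_gt0//; lra.
have re1 : r * e <= c by rewrite mulrC -ler_pdivlMr// ge_min lexx.
have re2 : r * e <= (r - s) / 2.
  have -> : (r - s) / 2 = (r - s) / (2 * r) * r by field; rewrite gt_eqF.
  by rewrite mulrC ler_pM2r// ge_min lexx orbT.
pose U := [set z | r < normc (f1 z)] `&` [set z | r < normc (f2 z)].
have oU : open U.
  by apply: openI; apply: open_gt_level; apply: (continuous_norm uA);
    exact: invertibles_ualg.
have [k Ik [k1 kx kU]] := weak_peak_invertible Xcompact X0 uA wx oU (conj r1 r2) e0.
have rC0 : r%:C != 0 by rewrite (inj_eq (@complexI R)) gt_eqF.
have nE z : normc ((cst r%:C * k) z) = r * normc (k z).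
  by rewrite !fctE normcM normc_real gtr0_norm.
exists (cst r%:C * k); first exact: (invertibles_scale uA).
have kmin z : r * normc (k z) <= Num.min (normc (f1 z)) (normc (f2 z)).
  have kz := k1 z; have kz0 := normc_ge0 (k z).
  have [[/= z1 z2]|nU] := pselect (U z).
    by rewrite le_min; apply/andP; split; nra.
  have : r * normc (k z) <= c by apply: le_trans re1; rewrite ler_pM2l// kU.
  rewrite /c !le_min => /andP[rc1 rc2]; apply/andP.
  by split; [exact: le_trans (f1c z)|exact: le_trans (f2c z)].
split=> [z|z|]; rewrite nE.
- by have := kmin z; rewrite le_min => /andP[].
- by have := kmin z; rewrite le_min => /andP[].
- have := ler_wpM2l (ltW r0) kx; lra.
Qed.

(** The defect w - Re h is at most d and vanishes at x, so it only needs to be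
    reduced off a neighbourhood of x; d (1 - p) does so for p peaking at x. *)
Lemma real_part_majorant_step x (w : X -> R) (d : R) h : choquet_boundary A x ->
  continuous w -> w x = 0 -> 0 < d ->
  [/\ A h, h x = 0 & forall z, w z - d <= Re (h z)] ->
  exists h', [/\ A h', h' x = 0, forall z, w z - d / 2 <= Re (h' z) &
    forall z, normc (h' z - h z) <= 3 * d].
Proof.
move=> chx cw wx0 d0 [Ah hx0 wh].
have wx := choquet_weak_peak Xcompact X0 uA chx.
pose U := [set z | w z - Re (h z) < d / 4].
have oU : open U.
  apply: (@open_lt_level R X (fun z => w z - Re (h z))) => z.
  by apply: cvgB; [exact: cw|exact: (continuous_Re uA Ah)].
have Ux : U x by rewrite /U /= wx0 hx0 subr0; lra.
have e0 : 0 < 5^-1 :> R by lra.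
have [k [Ak _] [k1 kx kU]] := weak_peak_invertible Xcompact X0 uA wx oU Ux e0.
have kx0 : 0 < normc (k x) by lra.
have [p [Ap px pE]] : exists p,
    [/\ A p, p x = 1 & forall z, normc (p z) = normc (k z) / normc (k x)].
  exists (cst (k x)^-1 * k); split=> [||z].
  - exact: (ualg_scale uA).
  - by rewrite !fctE mulVf// -normc_gt0.
  - by rewrite !fctE normcM normcV mulrC.
have p1 z : normc (p z) <= 5 / 4.
  by rewrite pE ler_pdivrMr//; have := k1 z; lra.
have pU z : ~ U z -> normc (p z) <= 4^-1.
  by move=> /kU kz; rewrite pE ler_pdivrMr//; lra.
exists (h + cst d%:C * (1 - p)).
have tE z : (h + cst d%:C * (1 - p)) z = h z + d%:C * (1 - p z) by [].
split=> [||z|z]; rewrite ?tE.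
- apply: (ualg_add uA) => //; apply: (ualg_scale uA).
  by apply: (ualg_sub uA) => //; exact: ualg_1.
- by rewrite hx0 px subrr mulr0 addr0.
- rewrite !ReImE /= mul0r subr0; have := Re_le_normc (p z); have := wh z.
  have [/= Uz|/pU pz] := pselect (U z).
    by move: Uz; rewrite /U /=; have := p1 z; nra.
  by nra.
- rewrite addrAC subrr add0r normcM normc_real gtr0_norm// mulrC ler_pM2r//.
  by have := normcD 1 (- p z); rewrite normcNE normc1; have := p1 z; lra.
Qed.

(** Bishop's construction: corrections of geometrically decreasing size halve
    the defect at each step while keeping the value 0 at x. *)
Theorem real_part_majorant x (w : X -> R) : choquet_boundary A x ->
  continuous w -> w x = 0 ->
  exists u, [/\ A u, u x = 0 & forall z, w z <= Re (u z)].
Proof.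
move=> chx cw wx0.
have [y _ ymax] := continuous_max_ex Xcompact X0 cw.
pose W := `|w y| + 1; have W0 : 0 < W by rewrite ltr_wpDl.
have wW z : w z <= W.
  by rewrite (le_trans (ymax z I))// (le_trans (ler_norm _))// lerDl.
pose d n : R := W * 2^-1 ^+ n.
have d0 n : 0 < d n by rewrite mulr_gt0// exprn_gt0.
pose P n h := [/\ A h, h x = 0 & forall z, w z - d n <= Re (h z)].
(* F picks a corrected function at each stage; s iterates it from 0 *)
have /choice[F FP] : forall nh : nat * (X -> R[i]), exists h', P nh.1 nh.2 ->
    P nh.1.+1 h' /\ forall z, normc (h' z - nh.2 z) <= 3 * d nh.1.
  move=> [n h]; have [Ph|nP] := pselect (P n h); last by exists 0.
  have [h' [Ah' h'x wh' hh']] := real_part_majorant_step chx cw wx0 (d0 n) Ph.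
  exists h' => _; split=> //; split=> // z; have := wh' z.
  by rewrite /d exprS; lra.
pose s := fix s n : X -> R[i] := if n is m.+1 then F (m, s m) else 0.
have Ps n : P n (s n).
  elim: n => [|n IH]; last exact: (FP (n, s n) IH).1.
  split=> [||z]; [exact: (ualg_cst uA 0)|by []|].
  by rewrite /d expr0 mulr1 /=; have := wW z; lra.
have sS n z : normc (s n.+1 z - s n z) <= 3 * W * 2^-1 ^+ n.
  by have := (FP (n, s n) (Ps n)).2 z; rewrite /d /= mulrA.
have /choice[u uP] : forall z, exists l, forall n,
    normc (l - s n z) <= 12 * d n.
  move=> z.
  have [|a aP] := geometric_limit (a := fun n => Re (s n z)) (C := 3 * W).
    by move=> n; rewrite -ReN -ReD; apply: le_trans (norm_Re_le _) (sS n z).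
  have [|b bP] := geometric_limit (a := fun n => Im (s n z)) (C := 3 * W).
    by move=> n; rewrite -ImN -ImD; apply: le_trans (norm_Im_le _) (sS n z).
  exists (a +i* b) => n; apply: le_trans (normc_le_ReIm _) _.
  by have := aP n; have := bP n; rewrite !ReImE /= /d; lra.
have small (e : R) : 0 < e -> exists n, 12 * d n <= e.
  move=> e0; have h : 0 <= (2^-1 : R) < 1 by apply/andP; split; lra.
  have [|n hn] := geometric_small h (e := e / (12 * W)).
    by rewrite divr_gt0//; lra.
  exists n; rewrite /d mulrA mulrC -ler_pdivlMr//; lra.
exists u; split.
- apply: (ualg_uniform_limit uA) => e /small[n dn].
  have [As _ _] := Ps n; exists (s n) => // z.
  exact: le_trans (uP z n) dn.
- apply: (@eq_of_normc_small R) => e /small[n dn].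
  have [_ sx _] := Ps n; have := uP x n; rewrite sx => h.
  exact: le_trans h dn.
- move=> z; apply/ler_addgt0Pr => e e0.
  have [n dn] := small (e / 2) (ltac:(lra)).
  have [_ _ /(_ z) wz] := Ps n.
  have := le_trans (norm_Re_le _) (uP z n); rewrite ReD ReN ler_norml.
  by have := d0 n; lra.
Qed.

Lemma eq0_normc1D_le1 (z : R[i]) : 0 <= Re z -> normc (1 + z) <= 1 -> z = 0.
Proof.
move=> z0 z1; have : normc (1 + z) ^+ 2 <= 1.
  by rewrite -[leRHS](expr1n _ 2) ler_sqr ?nnegrE ?normc_ge0.
rewrite normc_sqr !ReImE /=; case: z z0 {z1} => a b /= a0 s1.
have a00 : a = 0 by nra.
have b0 : b = 0.
  by apply/eqP; rewrite -sqrf_eq0 eq_le sqr_ge0 andbT; move: s1; rewrite a00; nra.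
by rewrite a00 b0.
Qed.

(** The multiplicative form of Bishop's lemma: q = 1 / (1 + u) with the real
    part of u at least twice |f / f(x) - 1| beats the growth of f. *)
Theorem peaking_multiplier x f : choquet_boundary A x -> A f -> f x != 0 ->
  exists q, [/\ invertibles A q, q x = 1, forall z, normc (q z) <= 1,
    forall z, normc (q z) = 1 -> q z = 1 &
    forall z, normc (f z * q z) <= normc (f x) /\
      (normc (f z * q z) = normc (f x) -> q z = 1 /\ f z = f x)].
Proof.
move=> chx Af fx0; pose g := cst (f x)^-1 * f - cst 1.
have Ag : A g by apply: (ualg_subc uA); exact: (ualg_scale uA).
have gE z : f z = f x * (1 + g z).
  by rewrite /g !fctE [1 + _]addrC subrK mulrA mulfV// mul1r.
have gx0 : g x = 0 by rewrite /g !fctE mulVf// subrr.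
have [||u [Au ux0 gu]] := real_part_majorant (w := fun z => 2 * normc (g z)) chx.
- move=> z; apply: cvgM; first exact: cvg_cst.
  exact: (continuous_norm uA Ag).
- by rewrite gx0 normc0 mulr0.
have u0 z : 0 <= Re (u z).
  by apply: le_trans (gu z); rewrite mulr_ge0// normc_ge0.
have Iu := invertibles_1D Xcompact X0 uA Au u0.
have qE z : normc (fun_inv (1 + u) z) = (normc (1 + u z))^-1.
  by rewrite /fun_inv normcV.
have uge z : 1 + 2 * normc (g z) <= normc (1 + u z).
  by have := Re_le_normc (1 + u z); rewrite ReD /=; have := gu z; lra.
have u1 z : 1 <= normc (1 + u z).
  by have := uge z; have := normc_ge0 (g z); lra.
have q1 z : normc (1 + u z) = 1 -> fun_inv (1 + u) z = 1.
  by move=> h; rewrite /fun_inv !fctE (@eq0_normc1D_le1 (u z)) ?addr0 ?invr1 ?h.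
have nfx : 0 < normc (f x) by rewrite normc_gt0.
have upos z : 0 < normc (1 + u z) by exact: lt_le_trans (u1 z).
have g1 z : normc (1 + g z) <= 1 + normc (g z).
  by have := normcD 1 (g z); rewrite normc1.
exists (fun_inv (1 + u)); split.
- exact: invertibles_inv.
- by rewrite /fun_inv !fctE ux0 addr0 invr1.
- by move=> z; rewrite qE invf_le1.
- by move=> z; rewrite qE => /eqP; rewrite invr_eq1 => /eqP; exact: q1.
- move=> z; rewrite normcM qE {1 2}gE normcM -mulrA.
  have gz := normc_ge0 (g z).
  split.
    rewrite -[leRHS]mulr1 ler_pM2l// ler_pdivrMr// mul1r.
    by have := uge z; have := g1 z; lra.
  rewrite -[X in _ = X -> _]mulr1 => /(mulfI (lt0r_neq0 nfx))/divr1_eq E.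
  have gz0 : normc (g z) = 0 by have := uge z; have := g1 z; lra.
  have g0 := eq0_normc gz0.
  by rewrite gE g0 addr0 mulr1; split=> //; apply: q1; rewrite -E g0 addr0 normc1.
Qed.

End PeakingFunctions.

(** * Norm-multiplicative correspondences between groups of invertibles *)

(** A relation rather than a map, so that the two algebras play symmetric
    roles although the map T is not known to be injective. *)
Record norm_correspondence (R : realType) (X Y : topologicalType)
    (A : set (X -> R[i])) (B : set (Y -> R[i]))
    (Rel : (X -> R[i]) -> (Y -> R[i]) -> Prop) : Prop := NormCorrespondence {
  corr_invl : forall f f', Rel f f' -> invertibles A f;
  corr_invr : forall f f', Rel f f' -> invertibles B f';
  corr_totl : forall f, invertibles A f -> exists f', Rel f f';
  corr_totr : forall f', invertibles B f' -> exists f, Rel f f';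
  corr_norm : forall f f' g g', Rel f f' -> Rel g g' -> forall c : R,
    (forall x, normc (f x * g x) <= c) <-> (forall y, normc (f' y * g' y) <= c) }.

Lemma norm_correspondence_sym (R : realType) (X Y : topologicalType)
    (A : set (X -> R[i])) (B : set (Y -> R[i])) Rel :
  norm_correspondence A B Rel ->
  norm_correspondence B A (fun f' f => Rel f f').
Proof.
move=> [invl invr totl totr norm].
apply: NormCorrespondence => [f' f|f' f|f'|f|f' f g' g ff' gg' c];
  [exact: invr|exact: invl|exact: totr|exact: totl|].
exact: iff_sym (norm _ _ _ _ ff' gg' c).
Qed.

Section CorrespondenceModuli.
Variables (R : realType) (X Y : topologicalType).
Variables (A : set (X -> R[i])) (B : set (Y -> R[i])).
Variable Rel : (X -> R[i]) -> (Y -> R[i]) -> Prop.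
Hypothesis cAB : norm_correspondence A B Rel.
(** Multiplying by a partner of the inverse of g' turns the comparison of f'
    with g' into a comparison of norms with 1. *)
Lemma corr_le f f' g g' : Rel f f' -> Rel g g' ->
  (forall x, normc (f x) <= normc (g x)) -> forall y, normc (f' y) <= normc (g' y).
Proof.
move=> ff' gg' fg y; have Ig' := corr_invr cAB gg'.
have [h hh'] := corr_totr cAB (invertibles_inv Ig').
have gh x : normc (g x * h x) <= 1.
  move: x; apply/(corr_norm cAB gg' hh') => y'.
  by rewrite /fun_inv mulfV ?normc1// (invertibles_neq0 _ Ig').
have : normc (f' y * fun_inv g' y) <= 1.
  move: y; apply/(corr_norm cAB ff' hh') => x; apply: le_trans (gh x).
  by rewrite !normcM ler_wpM2r// normc_ge0.
rewrite normcM /fun_inv normcV ler_pdivrMr ?mul1r//.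
by rewrite normc_gt0 (invertibles_neq0 _ Ig').
Qed.

(** The product of f' with the partner k' of 1 / f has norm 1; a partner of
    1 / f' provides the opposite inequality. *)
Lemma corr_inv f f' k' : Rel f f' -> Rel (fun_inv f) k' ->
  forall y, normc (k' y) = (normc (f' y))^-1.
Proof.
move=> ff' fk' y; have If := corr_invl cAB ff'; have If' := corr_invr cAB ff'.
have f'y : 0 < normc (f' y) by rewrite normc_gt0 (invertibles_neq0 _ If').
apply/eqP; rewrite eq_le; apply/andP; split.
  rewrite -[leRHS]mul1r ler_pdivlMr// -normcM mulrC.
  move: y {f'y}; apply/(corr_norm cAB ff' fk') => x.
  by rewrite /fun_inv mulfV ?normc1// (invertibles_neq0 _ If).
have [h hh'] := corr_totr cAB (invertibles_inv If').
rewrite -normcV; apply: (corr_le hh' fk') => x.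
have fx : 0 < normc (f x) by rewrite normc_gt0 (invertibles_neq0 _ If).
rewrite /fun_inv normcV -[leRHS]mul1r ler_pdivlMr// -normcM mulrC.
move: x {fx}; apply/(corr_norm cAB ff' hh') => z.
by rewrite /fun_inv mulfV ?normc1// (invertibles_neq0 _ If').
Qed.

Lemma corr_scale_le c f f' k' : Rel f f' -> Rel (cst c * f) k' ->
  forall y, normc (k' y) <= normc c * normc (f' y).
Proof.
move=> ff' fk' y; have If' := corr_invr cAB ff'.
have f'y : 0 < normc (f' y) by rewrite normc_gt0 (invertibles_neq0 _ If').
have [h hh'] := corr_totr cAB (invertibles_inv If').
rewrite -ler_pdivrMr// -normcV -normcM.
move: y {f'y}; apply/(corr_norm cAB fk' hh') => x.
rewrite !fctE -mulrA normcM -[leRHS]mulr1 ler_wpM2l ?normc_ge0//.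
move: x; apply/(corr_norm cAB ff' hh') => z.
by rewrite /fun_inv mulfV ?normc1// (invertibles_neq0 _ If').
Qed.

Lemma corr_scale c f f' k' : c != 0 -> Rel f f' -> Rel (cst c * f) k' ->
  forall y, normc (k' y) = normc c * normc (f' y).
Proof.
move=> c0 ff' fk' y; apply/eqP; rewrite eq_le (corr_scale_le ff')//=.
have ckf : Rel (cst c^-1 * (cst c * f)) f'.
  have -> : cst c^-1 * (cst c * f) = f by apply/funext => x; rewrite !fctE mulKf.
  by [].
have := corr_scale_le fk' ckf y; rewrite normcV mulrC ler_pdivlMr ?normc_gt0//.
by rewrite mulrC.
Qed.

End CorrespondenceModuli.

Section CorrespondencePoints.
Variables (R : realType) (X Y : topologicalType).
Hypotheses (Xcompact : compact [set: X]) (X0 : [set: X] !=set0).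
Hypotheses (Ycompact : compact [set: Y]) (Y0 : [set: Y] !=set0).
Variables (A : set (X -> R[i])) (B : set (Y -> R[i])).
Hypotheses (uA : uniform_algebra A) (uB : uniform_algebra B).
Variable Rel : (X -> R[i]) -> (Y -> R[i]) -> Prop.
Hypothesis cAB : norm_correspondence A B Rel.
Implicit Types (x : X) (y : Y).

Let cBA := norm_correspondence_sym cAB.

(** The sets where |g| >= 1, for the g whose partner exceeds 1 at y, are directed
    downwards by the existence of dominated peaks at y, so that compactness
    applies. *)
Lemma corr_point_or_gap y (C : set X) : choquet_boundary B y -> closed C ->
  (exists2 x, C x & forall f f', Rel f f' -> normc (f' y) <= normc (f x)) \/
  (exists g g', [/\ Rel g g', 1 < normc (g' y) & forall x, C x -> normc (g x) < 1]).
Proof.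
move=> chy clC; apply: contrapT => /not_orP[npoint ngap]; apply: npoint.
pose P (g : X -> R[i]) := exists2 g', Rel g g' & 1 < normc (g' y).
pose F (g : X -> R[i]) : set X := [set x | 1 <= normc (g x)].
have cC : compact C := subclosed_compact clC Xcompact (@subsetT _ C).
have [|g [g' gg' _]|g1 g2 [g1' gg1 g1y] [g2' gg2 g2y]|g [g' gg' gy]|x Cx xP] :=
  compact_directed (P := P) (F := F) cC.
- have [|g gg'] := corr_totr cAB (f' := cst 2).
    by apply: (invertibles_cst uB); rewrite pnatr_eq0.
  have n2 : 1 < normc (2%:R : R[i]).
    by rewrite -(rmorph_nat (real_complex R)) normc_real ger0_norm//; lra.
  by exists g; exists (cst 2%:R).
- apply: closed_ge_level; apply: (continuous_norm uA).
  exact: invertibles_ualg (corr_invl cAB gg').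
- have [h' Ih' [h1 h2 hy]] := dominated_peak Ycompact Y0 uB chy
    (corr_invr cAB gg1) (corr_invr cAB gg2) ltr01 g1y g2y.
  have [h hh'] := corr_totr cAB Ih'.
  exists h; first by exists h'.
  move=> x [_ hx]; split; apply: le_trans hx _.
    exact: (corr_le cBA hh' gg1).
  exact: (corr_le cBA hh' gg2).
- apply: contrapT => /nonemptyPn CF; apply: ngap; exists g, g'; split=> // x Cx.
  rewrite ltNge; apply/negP => gx.
  by suff : set0 x by []; rewrite -CF.
exists x => // f f' ff'; rewrite leNgt; apply/negP => fx.
have If := corr_invl cAB ff'.
pose t := (normc (f x) + normc (f' y)) / 2.
have [tx ty] : normc (f x) < t /\ t < normc (f' y) by rewrite /t; lra.
have t0 : 0 < t := le_lt_trans (normc_ge0 _) tx.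
have tC : t^-1%:C != 0 by rewrite (inj_eq (@complexI R)) invr_eq0 gt_eqF.
have nt : normc t^-1%:C = t^-1 by rewrite normc_real gtr0_norm// invr_gt0.
have [k' fk'] := corr_totl cAB (invertibles_scale uA tC If).
have : F (cst t^-1%:C * f) x.
  apply: xP; exists k' => //.
  by rewrite (corr_scale cAB tC ff' fk') nt mulrC ltr_pdivlMr// mul1r.
by rewrite /F /= !fctE normcM nt mulrC ler_pdivlMr// mul1r leNgt tx.
Qed.

(** The first alternative above with C the whole space gives one inequality, and
    the same inequality for the inverses gives the other. *)
Lemma corr_point y : choquet_boundary B y ->
  exists x, forall f f', Rel f f' -> normc (f' y) = normc (f x).
Proof.
move=> chy; have [[x _ xP]|[g [g' [gg' gy g1]]]] := corr_point_or_gap chy closedT.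
  exists x => f f' ff'; apply/eqP; rewrite eq_le (xP _ _ ff')/=.
  have If := corr_invl cAB ff'; have If' := corr_invr cAB ff'.
  have [k' fk'] := corr_totl cAB (invertibles_inv If).
  have := xP _ _ fk'; rewrite (corr_inv cAB ff' fk') /fun_inv normcV.
  by rewrite lef_pV2// posrE normc_gt0 ?(invertibles_neq0 _ If)
    ?(invertibles_neq0 _ If').
have [x xmax] := norm_max_ex Xcompact X0 uA (invertibles_ualg (corr_invl cAB gg')).
have := (corr_norm cAB gg' gg' (normc (g x) * normc (g x))).1.
move=> /(_ _ y); rewrite normcM => h.
have : normc (g' y) * normc (g' y) <= normc (g x) * normc (g x).
  by apply: h => z; rewrite normcM ler_pM// normc_ge0.
have := g1 x I; have := normc_ge0 (g x); nra.
Qed.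

(** The gap functions of the previous dichotomy, raised to high powers and cut
    down by a peak at y, provide peaks at the point that corresponds to y. *)
Lemma corr_choquet x y : choquet_boundary B y ->
  (forall f f', Rel f f' -> normc (f' y) = normc (f x)) -> choquet_boundary A x.
Proof.
move=> chy xy; apply: (has_peaks_choquet Xcompact X0 uA) => U e oU Ux e0.
have [[x' Ux' x'P]|[g [g' [gg' gy g1]]]] :=
    corr_point_or_gap chy (open_closedC oU).
  have xx' : x <> x' by move=> xx'; apply: Ux'; rewrite -xx'.
  have [a Ia [ax ax']] := invertibles_separate Xcompact X0 uA xx'.
  have [a' aa'] := corr_totl cAB Ia.
  have := x'P _ _ aa'; rewrite (xy _ _ aa') ax normc1; lra.
rewrite (xy _ _ gg') in gy; pose r := (normc (g x))^-1.
have gx0 : 0 < normc (g x) by lra.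
have r01 : 0 <= r < 1 by rewrite invr_ge0 ltW// invf_lt1.
have [r0 r1] := andP r01; have {}r0 : 0 < r by rewrite invr_gt0.
have [n rn] := geometric_small r01 e0.
have rC : r%:C != 0 by rewrite (inj_eq (@complexI R)) gt_eqF.
have [f [If fE]] : exists f, invertibles A f /\
    forall z, normc (f z) = (r * normc (g z)) ^+ n.
  exists ((cst r%:C * g) ^+ n); split.
    by apply: (invertibles_exp uA); apply: (invertibles_scale uA) => //;
      exact: (corr_invl cAB gg').
  move=> z; have -> : ((cst r%:C * g) ^+ n) z = (r%:C * g z) ^+ n.
    by elim: n {rn} => [//|n IH]; rewrite !exprS -IH.
  by rewrite normcX normcM normc_real gtr0_norm.
have [f' ff'] := corr_totl cAB If.
have f'y : normc (f' y) = 1.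
  by rewrite (xy _ _ ff') fE mulVf ?expr1n// gt_eqF.
pose s := 1 - Num.min e 2^-1.
have s2 : 2^-1 <= s.
  have : Num.min e 2^-1 <= 2^-1 by rewrite ge_min lexx orbT.
  by rewrite /s; lra.
have s1 : s < 1.
  have : 0 < Num.min e 2^-1 by rewrite lt_min e0/=; lra.
  by rewrite /s; lra.
have se : 1 - e <= s.
  have : Num.min e 2^-1 <= e by rewrite ge_min lexx.
  by rewrite /s; lra.
have [|||h' Ih' [h'f h'1 hy]] := dominated_peak Ycompact Y0 uB (s := s) chy
  (corr_invr cAB ff') (invertibles_1 uB).
- lra.
- by rewrite f'y.
- by rewrite normc1.
have [h hh'] := corr_totr cAB Ih'.
exists h; first exact: invertibles_ualg (corr_invl cAB hh').
split=> [z||z Uz].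
- have : normc (h z * h z) <= 1.
    move: z; apply/(corr_norm cAB hh' hh') => z.
    have := h'1 z; rewrite normc1 normcM => h1.
    by rewrite -[leRHS]mulr1 ler_pM// normc_ge0.
  rewrite normcM; have := normc_ge0 (h z); nra.
- by rewrite -(xy _ _ hh'); lra.
- apply: le_trans (corr_le cBA hh' ff' h'f z) _; rewrite fE.
  apply: le_trans rn; rewrite exprMn -[leRHS]mulr1 ler_wpM2l ?exprn_ge0 ?(ltW r0)//.
  by rewrite exprn_ile1 ?normc_ge0// ltW// g1.
Qed.

(** A peak at phi(y) exceeds 1/2 only near phi(y), and its partner has the same
    modulus at the points that correspond. *)
Lemma corr_continuous (phi : Y -> X) :
  (forall y, choquet_boundary B y ->
    forall f f', Rel f f' -> normc (f' y) = normc (f (phi y))) ->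
  {within choquet_boundary B, continuous phi}.
Proof.
move=> phiP; apply/subspace_continuousP => y chy W.
rewrite nbhsE => -[U [oU Uy] UW].
have wx := choquet_weak_peak Xcompact X0 uA (corr_choquet chy (phiP y chy)).
have e0 : 0 < 4^-1 :> R by lra.
have [k Ik [_ ky kU]] := weak_peak_invertible Xcompact X0 uA wx oU Uy e0.
have [k' kk'] := corr_totl cAB Ik.
have oV : open [set y' | 2^-1 < normc (k' y')].
  apply: open_gt_level; apply: (continuous_norm uB).
  exact: invertibles_ualg (corr_invr cAB kk').
have Vy : 2^-1 < normc (k' y) by rewrite (phiP y chy _ _ kk'); lra.
rewrite /= /within /=; near_simpl.
have : nbhs y [set y' | 2^-1 < normc (k' y')] by exact: open_nbhs_nbhs.
apply: filterS => y' /= Vy' chy'; apply: UW; apply: contrapT => /kU.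
by rewrite -(phiP y' chy' _ _ kk'); lra.
Qed.

End CorrespondencePoints.

(** * Peripherally spectrum-compressing maps *)

Section SpectralMap.
Variables (R : realType) (X Y : topologicalType).
Hypotheses (Xcompact : compact [set: X]) (X0 : [set: X] !=set0).
Hypotheses (Ycompact : compact [set: Y]) (Y0 : [set: Y] !=set0).
Variables (A : set (X -> R[i])) (B : set (Y -> R[i])).
Hypotheses (uA : uniform_algebra A) (uB : uniform_algebra B).
Variable T : (X -> R[i]) -> (Y -> R[i]).
Hypothesis T_into : set_fun (invertibles A) (invertibles B) T.
Hypothesis T_onto : set_surj (invertibles A) (invertibles B) T.
Hypothesis T_spec : forall f g, invertibles A f -> invertibles A g ->
  peripheral_spectrum B (T f * T g) `<=` peripheral_spectrum A (f * g).

Let Rel f f' := invertibles A f /\ f' = T f.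

Lemma spectral_norm_correspondence : norm_correspondence A B Rel.
Proof.
apply: NormCorrespondence.
- by move=> f f' [].
- by move=> f f' [If ->]; exact: T_into.
- by move=> f If; exists (T f).
- by move=> f' /T_onto[f If <-]; exists f.
move=> f f' g g' [If ->] [Ig ->] c.
have BTT : B (T f * T g).
  by apply: (ualg_mul uB); apply: invertibles_ualg; exact: T_into.
have Afg : A (f * g) by apply: (ualg_mul uA); exact: invertibles_ualg.
have [y ymax] := norm_max_ex Ycompact Y0 uB BTT.
have : peripheral_spectrum B (T f * T g) ((T f * T g) y).
  by apply/(peripheral_spectrumP Ycompact Y0 uB _ BTT); split=> //; exists y.
move=> /(T_spec If Ig)/(peripheral_spectrumP Xcompact X0 uA _ Afg)[[x xy] xmax].
split=> [fc y'|Tc x'].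
- by apply: le_trans (ymax y') _; rewrite -xy; exact: fc.
- by apply: le_trans (xmax x') _; exact: Tc.
Qed.

Let cAB := spectral_norm_correspondence.
Let I1 : invertibles A 1 := invertibles_1 uA.

(** The form in which the inclusion of the peripheral spectra is used: a value of
    T f T g that dominates |f g| also dominates |T f T g|, hence is peripheral. *)
Lemma spectral_value f g y : invertibles A f -> invertibles A g ->
  (forall x, normc (f x * g x) <= normc (T f y * T g y)) ->
  exists2 x, T f y * T g y = f x * g x &
    normc (f x * g x) = normc (T f y * T g y).
Proof.
move=> If Ig fgy.
have BTT : B (T f * T g).
  by apply: (ualg_mul uB); apply: invertibles_ualg; exact: T_into.
have Afg : A (f * g) by apply: (ualg_mul uA); exact: invertibles_ualg.
have : peripheral_spectrum B (T f * T g) ((T f * T g) y).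
  apply/(peripheral_spectrumP Ycompact Y0 uB _ BTT); split; first by exists y.
  by apply/(corr_norm cAB (conj If erefl) (conj Ig erefl)).
move=> /(T_spec If Ig)/(peripheral_spectrumP Xcompact X0 uA _ Afg)[[x xy] _].
by exists x; [exact: esym xy|exact: (congr1 (@normc R) xy)].
Qed.

(** T 1 is unimodular since 1 is its own inverse, so every value of T 1 * T 1 is
    peripheral, hence a value of 1. *)
Lemma spectral_T1_sqr y : T 1 y * T 1 y = 1.
Proof.
have n1 : normc (T 1 y) = 1.
  have inv1 : fun_inv (1 : X -> R[i]) = 1.
    by apply/funext => x; rewrite /fun_inv invr1.
  have R1 : Rel 1 (T 1) by [].
  have R1' : Rel (fun_inv 1) (T 1) by rewrite inv1.
  have := corr_inv cAB R1 R1' y.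
  have p : 0 < normc (T 1 y).
    by rewrite normc_gt0; exact: invertibles_neq0 (T_into I1).
  move=> /(congr1 (fun t => t * normc (T 1 y))); rewrite mulVf ?gt_eqF//.
  have p0 := ltW p; move: (normc _) p0 => t t0 t2.
  by apply/eqP; rewrite -(eqrXn2 (n := 2))// expr2 expr1n t2.
have [x|x -> _] := spectral_value (y := y) I1 I1.
  by rewrite [(1 : X -> R[i]) x * _]mulr1 normcM n1 mulr1 normc1.
by rewrite [LHS]mulr1.
Qed.

(** Testing T against a multiplier q that peaks, together with f q, only
    where q = 1 pins down the phase of T f y. *)
Lemma spectral_representation x y f : choquet_boundary A x ->
  (forall g, invertibles A g -> normc (T g y) = normc (g x)) ->
  invertibles A f -> T f y = T 1 y * f x.
Proof.
move=> chx xy If; have fx0 := invertibles_neq0 x If.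
have [q [Iq qx q1 qeq fq]] :=
  peaking_multiplier Xcompact X0 uA chx (invertibles_ualg If) fx0.
have Tq : T q y = T 1 y.
  have [z|z E nE] := spectral_value (y := y) Iq I1.
    rewrite [q z * _]mulr1 normcM (xy _ Iq) (xy _ I1) qx.
    by rewrite normc1 mulr1.
  rewrite [q z * _]mulr1 in E nE.
  have qz : q z = 1.
    by apply: qeq; rewrite nE normcM (xy _ Iq) (xy _ I1) qx normc1 mulr1.
  by rewrite -[LHS]mulr1 -(spectral_T1_sqr y) mulrA E qz mul1r.
have nfq : normc (T f y * T q y) = normc (f x).
  by rewrite normcM (xy _ If) (xy _ Iq) qx normc1 mulr1.
have [z|z E nE] := spectral_value (y := y) If Iq.
  by rewrite nfq; exact: (fq z).1.
have [qz fz] := (fq z).2 (etrans nE nfq).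
rewrite qz fz mulr1 Tq in E.
by rewrite -E mulrCA spectral_T1_sqr mulr1.
Qed.

Lemma choquet_homeomorphism_ex : exists phi : Y -> X,
  homeomorphism_on (choquet_boundary B) (choquet_boundary A) phi /\
  forall f, invertibles A f ->
    forall y, choquet_boundary B y -> T f y = T 1 y * f (phi y).
Proof.
have cBA := norm_correspondence_sym cAB.
have /choice[phi phiP] : forall y, exists x, choquet_boundary B y ->
    forall f f', Rel f f' -> normc (f' y) = normc (f x).
  move=> y; have [chy|nchy] := pselect (choquet_boundary B y).
    have [x xP] := corr_point Xcompact X0 Ycompact Y0 uA uB cAB chy.
    by exists x.
  by have [x _] := X0; exists x.
have /choice[psi psiP] : forall x, exists y, choquet_boundary A x ->
    forall f' f, Rel f f' -> normc (f x) = normc (f' y).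
  move=> x; have [chx|nchx] := pselect (choquet_boundary A x).
    have [y yP] := corr_point Ycompact Y0 Xcompact X0 uB uA cBA chx.
    by exists y.
  by have [y _] := Y0; exists y.
have phiC y : choquet_boundary B y -> choquet_boundary A (phi y).
  by move=> chy; exact: (corr_choquet Xcompact X0 Ycompact Y0 uA uB cAB chy (phiP y chy)).
have psiC x : choquet_boundary A x -> choquet_boundary B (psi x).
  by move=> chx; exact: (corr_choquet Ycompact Y0 Xcompact X0 uB uA cBA chx (psiP x chx)).
have sepY y1 y2 : (forall f f', Rel f f' -> normc (f' y1) = normc (f' y2)) ->
    y1 = y2.
  move=> h; apply: contrapT => y12.
  have [a' Ia' [a1 a2]] := invertibles_separate Ycompact Y0 uB y12.
  have [a aa'] := corr_totr cAB Ia'.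
  have := h _ _ aa'; rewrite a1 normc1; lra.
have sepX x1 x2 : (forall f f', Rel f f' -> normc (f x1) = normc (f x2)) ->
    x1 = x2.
  move=> h; apply: contrapT => x12.
  have [a Ia [a1 a2]] := invertibles_separate Xcompact X0 uA x12.
  have [a' aa'] := corr_totl cAB Ia.
  have := h _ _ aa'; rewrite a1 normc1; lra.
have phiK y : choquet_boundary B y -> psi (phi y) = y.
  move=> chy; apply: sepY => f f' ff'.
  by rewrite -(psiP _ (phiC y chy) _ _ ff') (phiP _ chy _ _ ff').
have psiK x : choquet_boundary A x -> phi (psi x) = x.
  move=> chx; apply: sepX => f f' ff'.
  by rewrite -(phiP _ (psiC x chx) _ _ ff') (psiP _ chx _ _ ff').
exists phi; split; last first.
  move=> f If y chy; apply: spectral_representation => //; first exact: phiC.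
  by move=> g Ig; exact: (phiP y chy g (T g)).
split.
- split=> [y|y1 y2|x chx]; first exact: phiC.
    by move=> /set_mem ch1 /set_mem ch2 E; rewrite -(phiK y1)// E phiK.
  by exists (psi x); [exact: psiC|exact: psiK].
- exact: (corr_continuous Xcompact X0 Ycompact Y0 uA uB cAB phiP).
- exists psi; first by move=> y /set_mem chy; exact: phiK.
  exact: (corr_continuous Ycompact Y0 Xcompact X0 uB uA cBA psiP).
Qed.

End SpectralMap.

Section Extension.
Variables (R : realType) (X : topologicalType).
Hypotheses (Xcompact : compact [set: X]) (X0 : [set: X] !=set0).
Variable A : set (X -> R[i]).
Hypothesis uA : uniform_algebra A.

Lemma choquet_eq f g : A f -> A g ->
  (forall x, choquet_boundary A x -> f x = g x) -> f = g.
Proof.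
move=> Af Ag fg; have [x chx xmax] := choquet_max_ex Xcompact X0 uA (ualg_sub uA Af Ag).
apply/funext => z; apply: (@eq_of_normc_small R) => e e0.
by have := xmax z; rewrite !fctE (fg x chx) subrr normc0 => /le_trans; apply; exact: ltW.
Qed.

Lemma invertibles_translate f : A f ->
  invertibles A (f + cst (supnorm f + 1)%:C).
Proof.
move=> Af; pose c := supnorm f + 1.
have fs x : normc (f x) <= supnorm f := supnorm_ub Xcompact X0 uA x Af.
have s0 : 0 <= supnorm f by have [x _] := X0; exact: le_trans (normc_ge0 _) (fs x).
have c0 : 0 < c by rewrite ltr_wpDl.
have cC : c%:C != 0 by rewrite (inj_eq (@complexI R)) gt_eqF.
have -> : f + cst c%:C = cst c%:C * (1 - cst (- c%:C^-1) * f).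
  apply/funext => x; rewrite !fctE mulNr opprK mulrDr mulrA mulfV// mul1r.
  by rewrite [c%:C * _]mulr1 addrC.
apply: (invertibles_scale uA) => //.
apply: (invertibles_neumann X0 uA (r := supnorm f / c)).
- exact: (ualg_scale uA).
- by rewrite ltr_pdivrMr// mul1r /c ltrDl.
- move=> x; rewrite !fctE normcM normcNE normcV normc_real gtr0_norm// mulrC.
  by rewrite ler_pM2r ?invr_gt0.
Qed.

End Extension.

Section CompositionIsomorphism.
Variables (R : realType) (X Y : topologicalType).
Hypotheses (Xcompact : compact [set: X]) (X0 : [set: X] !=set0).
Hypotheses (Ycompact : compact [set: Y]) (Y0 : [set: Y] !=set0).
Variables (A : set (X -> R[i])) (B : set (Y -> R[i])).
Hypotheses (uA : uniform_algebra A) (uB : uniform_algebra B).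

(** Elements of a uniform algebra are determined by their restrictions to the
    Choquet boundary, and so is their norm; an operator that acts there as
    composition with a bijection therefore respects the whole structure. *)
Lemma composition_isomorphism (phi : Y -> X) (S : (X -> R[i]) -> (Y -> R[i])) :
  set_bij (choquet_boundary B) (choquet_boundary A) phi ->
  set_fun A B S ->
  (forall f, A f -> forall y, choquet_boundary B y -> S f y = f (phi y)) ->
  (forall g, B g -> exists2 f, A f &
    forall y, choquet_boundary B y -> g y = f (phi y)) ->
  isometric_algebra_isomorphism A B S.
Proof.
move=> [phiC _ phiS] SB SE Sonto.
have eqB := choquet_eq Ycompact Y0 uB; have eqA := choquet_eq Xcompact X0 uA.
split.
- split=> [f Af|f g /set_mem Af /set_mem Ag SS|g Bg].
  + exact: SB.
  + apply: eqA => // x chx; have [y chy <-] := phiS x chx.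
    by rewrite -!SE// SS.
  + have [f Af fg] := Sonto g Bg; exists f => //.
    by apply: eqB => //; [exact: SB|move=> y chy; rewrite SE// fg].
- move=> a f g Af Ag; have Aaf := ualg_scale uA a Af.
  have Aafg := ualg_add uA Aaf Ag.
  apply: eqB; first exact: SB.
    by apply: (ualg_add uB); [apply: (ualg_scale uB)|]; exact: SB.
  by move=> y chy; rewrite SE// !fctE !SE.
- move=> f g Af Ag; have Afg := ualg_mul uA Af Ag.
  apply: eqB; [exact: SB|by apply: (ualg_mul uB); exact: SB|].
  by move=> y chy; rewrite SE// !fctE !SE.
- move=> f Af; apply/eqP; rewrite eq_le; apply/andP; split.
    apply: (supnorm_le Y0) => y.
    have [y0 chy0 y0max] := choquet_max_ex Ycompact Y0 uB (SB f Af).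
    apply: le_trans (y0max y) _; rewrite SE//.
    exact: (supnorm_ub Xcompact X0 uA).
  apply: (supnorm_le X0) => x.
  have [x0 chx0 x0max] := choquet_max_ex Xcompact X0 uA Af.
  apply: le_trans (x0max x) _; have [y chy <-] := phiS _ chx0.
  by rewrite -SE//; apply: (supnorm_ub Ycompact Y0 uB); exact: SB.
Qed.

End CompositionIsomorphism.

Theorem corollary4p1 (R : realType) (X Y : topologicalType)
    (X0 : [set: X] !=set0) (Xcompact : compact [set: X])
    (XT2 : hausdorff_space X)
    (Y0 : [set: Y] !=set0) (Ycompact : compact [set: Y])
    (YT2 : hausdorff_space Y)
    (A : set (X -> R[i])) (B : set (Y -> R[i]))
    (uA : uniform_algebra A) (uB : uniform_algebra B)
    (T : (X -> R[i]) -> (Y -> R[i]))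
    (T_into : set_fun (invertibles A) (invertibles B) T)
    (T_onto : set_surj (invertibles A) (invertibles B) T)
    (T_spec : forall f g, invertibles A f -> invertibles A g ->
       peripheral_spectrum B (T f * T g) `<=` peripheral_spectrum A (f * g)) :
  [/\ T 1 ^+ 2 = 1,
      exists2 phi : Y -> X,
        homeomorphism_on (choquet_boundary B) (choquet_boundary A) phi
        & forall f, invertibles A f ->
          forall y, choquet_boundary B y -> T f y = T 1 y * f (phi y),
      exists2 S : (X -> R[i]) -> (Y -> R[i]),
        isometric_algebra_isomorphism A B S
        & forall f, invertibles A f -> forall y, S f y = T f y / T 1 y
    & T 1 = 1 ->
      exists2 S : (X -> R[i]) -> (Y -> R[i]),
        isometric_algebra_isomorphism A B S
        & forall f, invertibles A f -> S f = T f].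
Proof.
have I1 := invertibles_1 uA.
have TA f : invertibles A f -> B (T f) by move=> /T_into; exact: invertibles_ualg.
have BT1 : B (T 1) := TA 1 I1.
have T1sq y : T 1 y * T 1 y = 1.
  exact: (spectral_T1_sqr Xcompact X0 Ycompact Y0 uA uB T_into T_onto T_spec).
have [phi [phiH phiT]] :=
  choquet_homeomorphism_ex Xcompact X0 Ycompact Y0 uA uB T_into T_onto T_spec.
pose c Z (f : Z -> R[i]) : R[i] := (supnorm f + 1)%:C.
(* f is translated to an invertible element, on which T / T 1 is known to be
   composition with phi *)
pose S (f : X -> R[i]) : Y -> R[i] := T 1 * T (f + cst (c X f)) - cst (c X f).
have AI f : A f -> invertibles A (f + cst (c X f)) by exact: invertibles_translate.
have SB : set_fun A B S.
  move=> f Af; apply: (ualg_subc uB); apply: (ualg_mul uB) => //.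
  by apply: TA; exact: AI.
have SE f : A f -> forall y, choquet_boundary B y -> S f y = f (phi y).
  move=> Af y chy; have := phiT _ (AI f Af) y chy.
  rewrite /S !fctE => ->; rewrite mulrA T1sq mul1r.
  by rewrite addrK.
have Siso : isometric_algebra_isomorphism A B S.
  have [phibij _ _] := phiH.
  apply: (composition_isomorphism Xcompact X0 Ycompact Y0 uA uB phibij SB SE).
  move=> g Bg; have Ig := invertibles_translate Ycompact Y0 uB Bg.
  have [k Ik Tk] := T_onto _ (invertibles_mul uB (T_into _ I1) Ig).
  exists (k - cst (c Y g)); first exact: (ualg_subc uA _ (invertibles_ualg Ik)).
  move=> y chy; have := phiT k Ik y chy; rewrite Tk !fctE.
  move=> /(congr1 (fun t => T 1 y * t)); rewrite !mulrA T1sq !mul1r => <-.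
  by rewrite addrK.
have ST f : invertibles A f -> S f = T 1 * T f.
  move=> If; have Af := invertibles_ualg If.
  apply: (choquet_eq Ycompact Y0 uB); first exact: SB.
    by apply: (ualg_mul uB) => //; exact: TA.
  by move=> y chy; rewrite SE// !fctE (phiT f If y chy) mulrA T1sq mul1r.
have T1V y : (T 1 y)^-1 = T 1 y.
  have T10 : T 1 y != 0 by exact: invertibles_neq0 (T_into _ I1).
  by rewrite -[LHS]mul1r -(T1sq y) mulfK.
split.
- by apply/funext => y; rewrite expr2 !fctE T1sq.
- by exists phi.
- exists S => // f If y; rewrite ST// !fctE T1V mulrC //.
- move=> T1; exists S => // f If; rewrite ST// T1 mul1r //.
Qed.
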